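(* Let $G$ and $H$ be finitely generated groups such that the finite group $A$ is a proper subgroup of both $G$ and $H$ and there exist $g\in G$, $h\in H$ with $g^{-1}Ag\cap A=1=h^{-1}Ah\cap A$. Then, for the amalgamated free product $G\ast_A H$, the rational subset membership problem and the submonoid membership problem are recursively equivalent.
   Context: $G\ast_A H$ denotes the free product of $G$ and $H$ amalgamated along the common subgroup $A=G\cap H$. Let $K$ be a group generated by a finite set $\Sigma$, let $\Sigma^{\pm1}=\Sigma\cup\Sigma^{-1}$ with $\Sigma^{-1}$ a disjoint copy of formal inverses, and let $\eta:(\Sigma^{\pm1})^*\to K$ be the canonical monoid homomorphism. The submonoid membership problem for $K$: given a finite set $\Delta\subseteq(\Sigma^{\pm1})^*$ and a word $w\in(\Sigma^{\pm1})^*$, is $\eta(w)\in\eta(\Delta^* )$? The rational subset membership problem for $K$: given a finite automaton $B$ over $\Sigma^{\pm1}$ and a word $w\in(\Sigma^{\pm1})^*$, is $\eta(w)\in\eta(L(B))$? Decidability of these problems does not depend on the choice of $\Sigma$. Two decision problems are recursively equivalent if each can be algorithmically (Turing) reduced to the other. *)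

(* Defs.v *)
From HB Require Import structures.
From mathcomp Require Import all_boot all_fingroup.
From mathcomp Require Import boolp classical_sets.

Set Implicit Arguments.
Unset Strict Implicit.
Unset Printing Implicit Defensive.

Local Open Scope classical_set_scope.
Local Open Scope group_scope.

(* The total functions recursive in X: the least class containing the basic
   functions and the characteristic function of X, and closed under
   composition, primitive recursion and minimization of regular functions. *)
Inductive recursive_in (X : set nat) :
    forall k : nat, (k.-tuple nat -> nat) -> Prop :=
| rec_oracle :
    @recursive_in X 1 (fun t => if `[< X (thead t) >] then 1%N else 0%N)
| rec_zero :
    @recursive_in X 0 (fun=> 0%N)
| rec_succ :
    @recursive_in X 1 (fun t => (thead t).+1)
| rec_proj (k : nat) (i : 'I_k) :
    @recursive_in X k (fun t => tnth t i)
| rec_comp (k m : nat) (f : m.-tuple nat -> nat)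
      (g : 'I_m -> k.-tuple nat -> nat) :
    recursive_in X f -> (forall i, recursive_in X (g i)) ->
    @recursive_in X k (fun t => f [tuple g i t | i < m])
| rec_prim (k : nat) (f : k.-tuple nat -> nat) (g : k.+2.-tuple nat -> nat) :
    recursive_in X f -> recursive_in X g ->
    @recursive_in X k.+1 (fun t =>
      let y : k.-tuple nat := [tuple of behead t] in
      nat_rect (fun=> nat) (f y) (fun x r => g [tuple of x :: r :: y])
        (thead t))
| rec_min (k : nat) (f : k.+1.-tuple nat -> nat)
      (f_regular : forall t : k.-tuple nat,
        exists x, f [tuple of x :: t] == 0%N) :
    recursive_in X f ->
    @recursive_in X k (fun t => ex_minn (f_regular t)).

(* A decision problem with instances in T is the set of its yes-instances;
   instances are encoded by natural numbers through [pickle], which on the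
   concrete types used below (built from nat, bool, 'I_n, pairs and sequences)
   is an explicit effective encoding with decidable image. *)
Definition codes (T : countType) (P : set T) : set nat := pickle @` P.

Definition turing_reducible (S T : countType) (P : set S) (Q : set T) : Prop :=
  @recursive_in (codes Q) 1
    (fun t => if `[< codes P (thead t) >] then 1%N else 0%N).

Definition recursively_equivalent (S T : countType) (P : set S) (Q : set T) :
    Prop :=
  turing_reducible P Q /\ turing_reducible Q P.

(* States are natural numbers; the finite state set is made of the initial
   state and the states occurring in the lists of final states and of
   transitions (p, a, q). *)
Record nfa (T : Type) := NFA {
  nfa_init : nat;
  nfa_final : seq nat;
  nfa_trans : seq (nat * T * nat)
}.

Definition triple_of_nfa (T : Type) (B : nfa T) :=
  (nfa_init B, nfa_final B, nfa_trans B).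
Definition nfa_of_triple (T : Type)
    (u : nat * seq nat * seq (nat * T * nat)) :=
  NFA u.1.1 u.1.2 u.2.
Lemma triple_of_nfaK (T : Type) :
  cancel (@triple_of_nfa T) (@nfa_of_triple T).
Proof. by case. Qed.

HB.instance Definition _ (T : countType) :=
  Countable.copy (nfa T) (can_type (@triple_of_nfaK T)).

Fixpoint nfa_accepts_from (T : eqType) (B : nfa T) (p : nat) (w : seq T) :
    bool :=
  if w is a :: v then
    has (fun e => [&& e.1.1 == p, e.1.2 == a & nfa_accepts_from B e.2 v])
      (nfa_trans B)
  else p \in nfa_final B.

Definition nfa_lang (T : eqType) (B : nfa T) : set (seq T) :=
  [set w | nfa_accepts_from B (nfa_init B) w].

(* The submonoid of the free monoid (seq T, ++) generated by D. *)
Definition star (T : eqType) (D : seq T -> Prop) : set (seq T) :=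
  [set flatten ws | ws in [set ws | forall w, w \in ws -> D w]].

(* The letter (i, false) stands for the i-th generator, (i, true) for its
   formal inverse. *)
Notation letter n := ('I_n * bool)%type.
Notation word n := (seq (letter n)).

Definition eta (K : groupType) (n : nat) (s : 'I_n -> K) (w : word n) : K :=
  \prod_(l <- w) (if l.2 then (s l.1)^-1 else s l.1).

Definition generates (K : groupType) (n : nat) (s : 'I_n -> K) : Prop :=
  range (eta s) = [set: K].

Definition finitely_generated (K : groupType) : Prop :=
  exists (n : nat) (s : 'I_n -> K), generates s.

(* The finite set of words of an instance is given by a list. *)
Definition submonoid_membership (K : groupType) (n : nat) (s : 'I_n -> K) :
    set (seq (word n) * word n) :=
  [set I | (eta s @` star [set u | u \in I.1]) (eta s I.2)].

Definition rational_subset_membership (K : groupType) (n : nat)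
    (s : 'I_n -> K) : set (nfa (letter n) * word n) :=
  [set I | (eta s @` nfa_lang I.1) (eta s I.2)].

(* K, with iG and iH, is the free product of G and H amalgamated along A, seen
   as a subgroup of G and of H through jG and jH: it is the pushout.  A
   [groupType] may be infinite, and a [multiplicative] map between groups
   preserves 1 and inverses. *)
Definition is_amalgam (A G H K : groupType)
    (jG : {multiplicative A -> G}) (jH : {multiplicative A -> H})
    (iG : {multiplicative G -> K}) (iH : {multiplicative H -> K}) : Prop :=
  (forall a, iG (jG a) = iH (jH a)) /\
  forall (L : groupType)
      (f : {multiplicative G -> L}) (h : {multiplicative H -> L}),
    (forall a, f (jG a) = h (jH a)) ->
    (exists u : {multiplicative K -> L},
      (forall x, u (iG x) = f x) /\ (forall y, u (iH y) = h y)) /\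
    (forall u v : {multiplicative K -> L},
      (forall x, u (iG x) = v (iG x)) -> (forall y, u (iH y) = v (iH y)) ->
      forall z, u z = v z).

(* Main.v *)
Require Import Defs.
From HB Require Import structures.
From mathcomp Require Import all_boot all_fingroup.
From mathcomp Require Import boolp classical_sets.

(** One reduction is easy: the submonoid generated by finitely many words is the
    language of an automaton ([nfa_lang_star]), so submonoid membership is a
    special case of rational subset membership.

    For the converse, let an automaton and a word w be given.  Spelling every
    label as a product of elements of G and H, and letting the final states
    continue along a path that reads the inverse of w, turns the question into:
    is there a path labelled 1 between two vertices of a finite graph whose
    edges carry elements of G or H ([spelled_correct])?  By the normal form
    theorem for amalgams, a nonempty product that alternates between elements of
    G outside A and elements of H outside A is not in A.  So if the label of a
    path is in A, some maximal stretch of it inside one factor has its label in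
    A too.  Recording such a stretch as a single edge, labelled by an element of
    the finite group A, shortens the path; hence, once no new edge can be
    recorded, every path whose label is in A is matched by a recorded edge
    ([amalgamated_path_closed]).  Only finitely many edges can be recorded, so
    this process terminates ([saturate_closed]).

    Each round asks finitely many questions of the form: does an edge path
    inside one factor lead from p to q with label a?  They are put to the
    submonoid oracle.  Attach to every state q an element c_q of K, and let an
    edge (p, x, q) contribute the generator c_p^-1 x c_q.  Along a path the inner
    c's cancel.  Conversely the c's are chosen such that nothing else cancels:
    if a product of generators equals c_p^-1 a c_q, then it comes from a path
    ([encoding_faithful]).  This uses an element of each factor that conjugates
    A to a group meeting A trivially, and two elements u, v of one factor with
    u, v and u v^-1 outside A.  If there are no such u and v in either factor,
    then A has index two in both, and the conjugation hypothesis forces A to be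
    trivial; both factors are then of order two, and one records edges labelled
    by elements of the factors, combining them by the multiplication table and
    using the oracle only for the word problem ([finite_rule]).

    Both normal form arguments are played as ping-pong on the set of normal
    forms, on which K acts by its universal property ([amalgam_ping_pong]).
    That the algorithms are recursive is derived from closure properties of the
    functions computable on codes of lists and pairs ([computable]). *)
Set Implicit Arguments.
Unset Strict Implicit.
Unset Printing Implicit Defensive.

Local Open Scope nat_scope.

(** * Recursive functions and the coding of lists *)

Section Recursive.
Variable X : set nat.

(** The arguments are read off a list, so that functions need not carry the
    proof that their argument has length [k]. *)
Definition recs k (F : seq nat -> nat) : Prop :=
  @recursive_in X k (fun t => F t).

Lemma recs_ext k F G : (forall s, size s = k -> F s = G s) ->
  recs k F -> recs k G.
Proof.
rewrite /recs => eqFG; congr recursive_in; apply/funext => t.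
by apply: eqFG; rewrite size_tuple.
Qed.

Lemma recs_nth k i : i < k -> recs k (fun s => nth 0 s i).
Proof.
move=> ltik; rewrite /recs.
have -> : (fun t : k.-tuple nat => nth 0 t i) = (fun t => tnth t (Ordinal ltik)).
  by apply/funext => t; rewrite (tnth_nth 0).
exact: rec_proj.
Qed.

Lemma recs_head k : recs k.+1 (head 0).
Proof.
by apply: recs_ext (@recs_nth k.+1 0 _) => // s _; rewrite nth0.
Qed.

Lemma recs_comp k m F (Gs : seq (seq nat -> nat)) : size Gs = m ->
  recs m F -> (forall i, i < m -> recs k (nth (fun=> 0) Gs i)) ->
  recs k (fun s => F [seq G s | G <- Gs]).
Proof.
move=> szG recF recG.
have := rec_comp recF (fun i : 'I_m => recG i (ltn_ord i)).
rewrite /recs; congr recursive_in; apply/funext => t; congr (F _).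
apply: (@eq_from_nth _ 0); rewrite size_tuple ?size_map // => i lti.
by rewrite -(tnth_nth 0 _ (Ordinal lti)) tnth_mktuple (nth_map (fun=> 0)) ?szG.
Qed.

Lemma recs_succ k f : recs k f -> recs k (fun s => (f s).+1).
Proof.
move=> recf; apply: (@recs_comp k 1 (fun s => (head 0 s).+1) [:: f]) => //.
  have := @rec_succ X; rewrite /recs; congr recursive_in.
  by apply/funext => t; rewrite /thead (tnth_nth 0) nth0.
by case.
Qed.

Lemma recs_const k c : recs k (fun=> c).
Proof.
elim: c => [|c]; last exact: recs_succ.
by apply: (@recs_comp k 0 (fun=> 0) [::]) => //; exact: rec_zero.
Qed.

(** Parameters stay available under the additional variable of a recursion. *)
Lemma recs_weaken k f : recs k f -> recs k.+1 (fun s => f (behead s)).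
Proof.
move=> recf; pose Gs := [seq (fun s => nth 0 s i.+1) | i <- iota 0 k].
have szG : size Gs = k by rewrite size_map size_iota.
have /recs_ext : recs k.+1 (fun s => f [seq G s | G <- Gs]).
  apply: (recs_comp szG recf) => i ltik.
  rewrite /Gs (nth_map 0) ?size_iota // nth_iota // add0n.
  exact: recs_nth.
apply=> -[|x s] //= [szs]; congr (f _); rewrite /Gs -map_comp /=.
apply: (@eq_from_nth _ 0); rewrite size_map size_iota // => i lti.
by rewrite (nth_map 0) ?size_iota // nth_iota.
Qed.

Lemma recs_iter k f g n : recs k f ->
  recs k.+1 (fun s => g (behead s) (head 0 s)) -> recs k n ->
  recs k (fun s => iter (n s) (g s) (f s)).
Proof.
move=> recf recg recn.
pose P (s : seq nat) := iter (head 0 s) (g (behead s)) (f (behead s)).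
have recP : recs k.+1 P.
  have recg2 : recs k.+2 (fun s => g (behead (behead s)) (nth 0 s 1)).
    pose Gs := (fun s => nth 0 s 1) ::
                 [seq (fun s => nth 0 s i.+2) | i <- iota 0 k].
    have szG : size Gs = k.+1 by rewrite /= size_map size_iota.
    have /recs_ext : recs k.+2 (fun s =>
        (fun s => g (behead s) (head 0 s)) [seq G s | G <- Gs]).
      apply: (recs_comp szG recg) => -[|i] //= ltik; first exact: recs_nth.
      rewrite (nth_map 0) ?size_iota // nth_iota // add0n.
      exact: recs_nth.
    apply=> -[|x [|y s]] //= [szs]; congr (g _); rewrite -map_comp /=.
    apply: (@eq_from_nth _ 0); rewrite size_map size_iota // => i lti.
    by rewrite (nth_map 0) ?size_iota // nth_iota.
  have := rec_prim recf recg2; rewrite /recs; congr recursive_in.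
  by apply/funext => -[[|x s]].
pose Gs := n :: [seq (fun s => nth 0 s i) | i <- iota 0 k].
have szG : size Gs = k.+1 by rewrite /= size_map size_iota.
have /recs_ext : recs k (fun s => P [seq G s | G <- Gs]).
  apply: (recs_comp szG recP) => -[|i] //= ltik.
  rewrite (nth_map 0) ?size_iota // nth_iota // add0n.
  exact: recs_nth.
apply=> s szs; rewrite /P /= -map_comp.
suff -> : [seq nth 0 s i | i <- iota 0 k] = s by [].
by rewrite -szs; exact: mkseq_nth.
Qed.

Lemma recs_if0 k c f g : recs k c -> recs k f -> recs k g ->
  recs k (fun s => if c s is 0 then f s else g s).
Proof.
move=> recc recf recg.
have /recs_ext : recs k (fun s => iter (c s) (fun=> g s) (f s)).
  by apply: recs_iter => //; exact: recs_weaken.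
by apply=> s _; case: (c s).
Qed.

Lemma recs_add k f g : recs k f -> recs k g -> recs k (fun s => f s + g s).
Proof.
move=> recf recg.
have /recs_ext : recs k (fun s => iter (f s) succn (g s)).
  by apply: recs_iter => //; exact/recs_succ/recs_head.
by apply=> s _; elim: (f s) => //= m ->.
Qed.

Lemma recs_double k f : recs k f -> recs k (fun s => (f s).*2).
Proof.
by move=> recf; apply: recs_ext (recs_add recf recf) => s _; rewrite addnn.
Qed.

(** The step of [CodeSeq.code]: a bijection from pairs of numbers onto the
    positive numbers. *)
Definition cons_code a b := 2 ^ a * b.*2.+1.

Lemma recs_cons_code k f g : recs k f -> recs k g ->
  recs k (fun s => cons_code (f s) (g s)).
Proof.
move=> recf recg.
have /recs_ext : recs k (fun s => iter (f s) double (g s).*2.+1).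
  apply: recs_iter => //; first exact/recs_succ/recs_double.
  exact/recs_double/recs_head.
apply=> s _; rewrite /cons_code; elim: (f s) => [|m IHm]; first by rewrite mul1n.
by rewrite iterS IHm expnS -mulnA mul2n.
Qed.

Lemma recs_odd k f : recs k f -> recs k (fun s => odd (f s)).
Proof.
move=> recf.
have /recs_ext : recs k (fun s =>
    iter (f s) (fun y => if y is 0 then 1 else 0) 0).
  apply: recs_iter => //; first exact: recs_const.
  by apply: recs_if0; [exact: recs_head | exact: recs_const..].
by apply=> s _; elim: (f s) => //= m ->; case: odd.
Qed.

Lemma recs_half k f : recs k f -> recs k (fun s => (f s)./2).
Proof.
move=> recf.
have rec1 : recs 1 (fun s => (head 0 s)./2).
  have recg : recs 2 (fun s => if nat_of_bool (odd (nth 0 s 0)) is 0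
      then nth 0 s 1 else (nth 0 s 1).+1).
    apply: recs_if0; first exact/recs_odd/recs_nth.
      exact: recs_nth.
    exact/recs_succ/recs_nth.
  have := rec_prim (@rec_zero X) recg; rewrite /recs; congr recursive_in.
  apply/funext => -[[|x s] //= szs]; rewrite /thead (tnth_nth 0) /=.
  elim: x {szs} => //= x ->.
  by rewrite uphalf_half; case: (odd x); rewrite ?add1n ?add0n.
by apply: (@recs_comp k 1 (fun s => (head 0 s)./2) [:: f]) => //; case.
Qed.

Fact uncons_codeP c : exists n, (c == 0) || odd (iter n half c).
Proof.
have [->|] := eqVneq c 0; first by exists 0.
have [m] := ubnP c; elim: m c => // m IHm c ltcm nz_c.
case odd_c: (odd c); first by exists 0; rewrite odd_c.
have [||n] := IHm c./2.
- apply: (@leq_trans c) => //.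
  by rewrite ltn_half_double -muln2 ltn_Pmulr // lt0n.
- by apply: contra nz_c => /eqP c0; rewrite -[c]odd_double_half odd_c c0.
case: (c./2 =P 0) => [c0|_ /= Hn]; last by exists n.+1; rewrite iterSr Hn.
by rewrite -[c]odd_double_half odd_c c0 in nz_c.
Qed.

(** The exponent of 2 in [c], found by unbounded search; the alternative
    [c == 0] in [uncons_codeP] makes the search regular. *)
Definition head_code c := ex_minn (uncons_codeP c).
Definition tail_code c := iter (head_code c).+1 half c.

Lemma iter_half_cons_code a b : iter a half (cons_code a b) = b.*2.+1.
Proof.
rewrite /cons_code; elim: a => [|a IHa]; first by rewrite mul1n.
by rewrite iterSr expnS -mulnA mul2n doubleK.
Qed.

Lemma cons_code_neq0 a b : cons_code a b != 0.
Proof. by rewrite /cons_code muln_eq0 expn_eq0. Qed.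

Lemma head_cons_code a b : head_code (cons_code a b) = a.
Proof.
rewrite /head_code; case: ex_minnP => n.
rewrite (negPf (cons_code_neq0 _ _)) /= => odd_n min_n.
have /min_n : odd (iter a half (cons_code a b)).
  by rewrite iter_half_cons_code /= odd_double.
rewrite leq_eqVlt => /predU1P[//|lt_na].
move: odd_n; rewrite -(subnKC lt_na) addSnnS /cons_code expnD -mulnA.
move: (a - n.+1) => d; elim: n {min_n lt_na} => [|n IHn]; last first.
  by rewrite iterSr expnS -mulnA mul2n doubleK => /IHn {1}->.
by rewrite expn0 mul1n expnS -mulnA mul2n /= odd_double.
Qed.

Lemma tail_cons_code a b : tail_code (cons_code a b) = b.
Proof.
by rewrite /tail_code head_cons_code iterS iter_half_cons_code /= uphalf_double.
Qed.

Lemma recs_iter_half k n f : recs k n -> recs k f ->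
  recs k (fun s => iter (n s) half (f s)).
Proof. by move=> recn recf; apply: recs_iter => //; exact/recs_half/recs_head. Qed.

Lemma recs_head_code k f : recs k f -> recs k (fun s => head_code (f s)).
Proof.
move=> recf;
  apply: (@recs_comp k 1 (fun s => head_code (head 0 s)) [:: f]) => //;
    last by case.
pose F (s : seq nat) := if nth 0 s 1 is 0 then 0 else
  (if nat_of_bool (odd (iter (nth 0 s 0) half (nth 0 s 1))) is 0 then 1 else 0).
have F0 n c : (F [:: n; c] == 0) = (c == 0) || odd (iter n half c).
  by rewrite /F /=; case: c => //= c; case: odd.
have regF (t : 1.-tuple nat) : exists x, F [tuple of x :: t] == 0.
  case: t => -[|c [|]] //= _; have [n Hn] := uncons_codeP c.
  by exists n; rewrite F0.
have recF : recs 2 F.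
  apply: recs_if0; [exact: recs_nth | exact: recs_const |].
  apply: recs_if0; [|exact: recs_const..].
  by apply/recs_odd/recs_iter_half; exact: recs_nth.
have := @rec_min X 1 (fun t => F t) regF recF.
rewrite /recs; congr recursive_in; apply/funext => -[[|c [|]] //= szc].
rewrite /head_code; case: ex_minnP => m m0 min_m; case: ex_minnP => n n0 min_n.
rewrite /= in m0 min_m; apply/eqP; rewrite eqn_leq min_m ?F0 //= min_n // -F0 //.
Qed.

Lemma recs_tail_code k f : recs k f -> recs k (fun s => tail_code (f s)).
Proof.
by move=> recf; apply: recs_iter_half => //; exact/recs_succ/recs_head_code.
Qed.

End Recursive.

(** * Computable functions between countable types *)

Section Computable.
Variable X : set nat.
Notation recs := (recs X).

Lemma recs_pred k f : recs k f -> recs k (fun s => (f s).-1).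
Proof.
move=> recf; have rec0 := recs_const X k 0.
(* Halving 2 ^ a gives 2 ^ (a - 1), whose exponent is then read off. *)
apply: recs_ext (recs_head_code (recs_half (recs_cons_code recf rec0))).
move=> s _; case: (f s) => [|a].
  rewrite /cons_code /head_code; case: ex_minnP => n _ /(_ 0).
  by move=> le_n0; apply/eqP; rewrite -leqn0 le_n0.
by rewrite -[RHS](head_cons_code a 0) /cons_code expnS -mulnA mul2n doubleK.
Qed.

Lemma recs_eqn k f g : recs k f -> recs k g -> recs k (fun s => f s == g s).
Proof.
move=> recf recg.
have recB f1 g1 : recs k f1 -> recs k g1 -> recs k (fun s => f1 s - g1 s).
  move=> rec1 rec2.
  have /recs_ext : recs k (fun s => iter (g1 s) predn (f1 s)).
    by apply: recs_iter => //; exact/recs_pred/recs_head.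
  by apply=> s _; elim: (g1 s) => [|m /= ->]; rewrite ?subn0 ?subnS.
have := recs_if0 (recs_add (recB _ _ recf recg) (recB _ _ recg recf))
  (recs_const X k 1) (recs_const X k 0).
apply: recs_ext => s _; rewrite eqn_leq.
rewrite -subn_eq0 -[g s <= f s]subn_eq0 -addn_eq0.
by case: (_ + _).
Qed.

Definition rec1 (F : nat -> nat) := recs 1 (fun s => F (head 0 s)).

Lemma rec1_comp k F f : rec1 F -> recs k f -> recs k (fun s => F (f s)).
Proof.
by move=> recF recf;
  apply: (@recs_comp X k 1 (fun s => F (head 0 s)) [:: f]) => //; case.
Qed.

Lemma rec1_id : rec1 id. Proof. exact: recs_head. Qed.

(** [F] is arbitrary on numbers that are not codes: being a code is decided
    separately, see [decidable_codes]. *)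
Definition computable (S T : countType) (f : S -> T) : Prop :=
  exists2 F, rec1 F & forall x, F (pickle x) = pickle (f x).

Lemma computable_ext (S T : countType) (f g : S -> T) : f =1 g ->
  computable f -> computable g.
Proof. by move=> /funext ->. Qed.

Lemma computable_id (S : countType) : computable (@id S).
Proof. by exists id => //; exact: rec1_id. Qed.

Lemma computable_pickle (S T : countType) (f : S -> T) :
  computable f -> computable (fun x => pickle (f x)).
Proof. by []. Qed.

Lemma computable_cst (S T : countType) (y : T) : computable (fun _ : S => y).
Proof. by exists (fun=> pickle y) => //; exact: recs_const. Qed.

Lemma computable_comp (S T U : countType) (g : T -> U) (f : S -> T) :
  computable g -> computable f -> computable (fun x => g (f x)).
Proof.
move=> [G recG GE] [F recF FE]; exists (fun x => G (F x)); last first.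
  by move=> x; rewrite FE GE.
exact: (rec1_comp recG recF).
Qed.

Lemma pickle_pair (S T : countType) (x : S) (y : T) :
  pickle (x, y) = cons_code (pickle x) (cons_code (pickle y) 0).
Proof. by []. Qed.

Lemma pickle_cons (S : countType) (x : S) (s : seq S) :
  pickle (x :: s) = cons_code (pickle x) (pickle s).
Proof. by []. Qed.

Section Closure.
Variables S T U : countType.

Lemma computable_pair (f : S -> T) (g : S -> U) :
  computable f -> computable g -> computable (fun x => (f x, g x)).
Proof.
move=> [F recF FE] [G recG GE].
exists (fun c => cons_code (F c) (cons_code (G c) 0)).
  apply: recs_cons_code => //; apply: recs_cons_code => //; exact: recs_const.
by move=> x; rewrite FE GE pickle_pair.
Qed.

Lemma computable_fst (f : S -> T * U) :
  computable f -> computable (fun x => (f x).1).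
Proof.
move=> compf; apply: computable_comp compf.
exists head_code; first exact/recs_head_code/recs_head.
by case=> x y; rewrite pickle_pair head_cons_code.
Qed.

Lemma computable_snd (f : S -> T * U) :
  computable f -> computable (fun x => (f x).2).
Proof.
move=> compf; apply: computable_comp compf.
exists (fun c => head_code (tail_code c)).
  exact/recs_head_code/recs_tail_code/recs_head.
by case=> x y; rewrite pickle_pair tail_cons_code head_cons_code.
Qed.

Lemma computable_iter (n : S -> nat) (g : S -> T -> T) (f : S -> T) :
  computable n -> computable (fun p => g p.1 p.2) -> computable f ->
  computable (fun x => iter (n x) (g x) (f x)).
Proof.
move=> [N recN NE] [G recG GE] [F recF FE].
exists (fun c => iter (N c) (fun y => G (cons_code c (cons_code y 0))) (F c)).
  apply: (recs_iter (g := fun s y => G (cons_code (head 0 s) (cons_code y 0))))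
    => //.
  apply: rec1_comp recG _.
  apply: recs_cons_code; first exact/recs_weaken/recs_head.
  by apply: recs_cons_code; [exact: recs_head | exact: recs_const].
move=> x; rewrite NE FE; elim: (n x) => //= m ->.
by rewrite -pickle_pair GE.
Qed.

Lemma computable_cons (f : S -> T) (g : S -> seq T) :
  computable f -> computable g -> computable (fun x => f x :: g x).
Proof.
move=> [F recF FE] [G recG GE]; exists (fun c => cons_code (F c) (G c)).
  exact: recs_cons_code.
by move=> x; rewrite FE GE.
Qed.

Lemma computable_succ (f : S -> nat) :
  computable f -> computable (fun x => (f x).+1).
Proof.
move=> [F recF FE]; exists (fun c => (F c).+1); first exact: recs_succ.
by move=> x; rewrite FE.
Qed.

Lemma computable_if (b : S -> bool) (f g : S -> T) :
  computable b -> computable f -> computable g ->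
  computable (fun x => if b x then f x else g x).
Proof.
move=> [B recB BE] [F recF FE] [G recG GE].
exists (fun c => if nat_of_bool (B c == pickle false) is 0 then F c else G c).
  apply: recs_if0 => //; apply: recs_eqn => //; exact: recs_const.
move=> x; rewrite BE (inj_eq (pcan_inj pickleK)).
by case: (b x); rewrite ?FE ?GE.
Qed.

Lemma computable_eq (f g : S -> T) :
  computable f -> computable g -> computable (fun x => f x == g x).
Proof.
move=> [F recF FE] [G recG GE].
exists (fun c => if nat_of_bool (F c == G c) is 0
  then pickle false else pickle true).
  apply: recs_if0; first exact: recs_eqn.
    exact: recs_const.
  exact: recs_const.
by move=> x; rewrite FE GE (inj_eq (pcan_inj pickleK)); case: eqP.
Qed.

Lemma computable_case (l : S -> seq T) (f : S -> U) (g : S -> T -> seq T -> U) :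
  computable l -> computable f -> computable (fun p => g p.1 p.2.1 p.2.2) ->
  computable (fun x => if l x is e :: l' then g x e l' else f x).
Proof.
move=> [L recL LE] [F recF FE] [G recG GE].
exists (fun c => if L c is 0 then F c else
  G (cons_code c (cons_code (cons_code (head_code (L c))
                                   (cons_code (tail_code (L c)) 0)) 0))).
  apply: recs_if0 => //; apply: rec1_comp recG _.
  have rec0 := recs_const X 1 0.
  apply: recs_cons_code; first exact: recs_head.
  do 2![apply: recs_cons_code => //]; first exact: recs_head_code.
  by apply: recs_cons_code => //; exact: recs_tail_code.
move=> x; rewrite LE; case: (l x) => [|e l']; first by rewrite FE.
rewrite pickle_cons head_cons_code tail_cons_code -!pickle_pair GE /=.
by have := cons_code_neq0 (pickle e) (pickle l'); case: (cons_code _ _).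
Qed.

End Closure.

Lemma computable_andb (S : countType) (a b : S -> bool) :
  computable a -> computable b -> computable (fun x => a x && b x).
Proof.
move=> compa compb.
exact: computable_if compa compb (computable_cst _ false).
Qed.

Lemma computable_orb (S : countType) (a b : S -> bool) :
  computable a -> computable b -> computable (fun x => a x || b x).
Proof.
move=> compa compb.
exact: computable_if compa (computable_cst _ true) compb.
Qed.

(** The table of values is built into the program. *)
Lemma computable_fin (S : finType) (T : countType) (f : S -> T) : computable f.
Proof.
have [F recF FE] : exists2 F, rec1 F &
    forall x : S, x \in enum S -> F (pickle x) = pickle (f x).
  elim: (enum S) => [|a s [F recF FE]].
    by exists id => //; exact: rec1_id.
  exists (fun c => if nat_of_bool (c == pickle a) is 0 then F c
                   else pickle (f a)).
    apply: recs_if0 => //; last exact: recs_const.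
    by apply: recs_eqn; [exact: recs_head | exact: recs_const].
  move=> x; rewrite inE (inj_eq (pcan_inj pickleK)).
  by case: eqP => [->|_] //= /FE.
by exists F => // x; apply: FE; rewrite mem_enum.
Qed.

End Computable.

(** The goal is matched syntactically, because unification up to conversion
    would apply the closure lemmas to goals of any shape. *)
Ltac comp_step := cbn beta; lazymatch goal with
  | |- computable _ (fun x => x) => exact: computable_id
  | |- computable _ (fun _ => ?c) => exact: computable_cst
  | |- computable _ fst => apply: (computable_fst (f := fun x => x))
  | |- computable _ snd => apply: (computable_snd (f := fun x => x))
  | |- computable _ (fun x => (@?f x, @?g x)) => apply: computable_pair
  | |- computable _ (fun x => (@?f x).1) => apply: (computable_fst (f := f))
  | |- computable _ (fun x => (@?f x).2) => apply: (computable_snd (f := f))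
  | |- computable _ (fun x => @?f x :: @?g x) => apply: computable_cons
  | |- computable _ (fun x => (@?f x).+1) => apply: computable_succ
  | |- computable _ (fun x => @?f x == @?g x) => apply: computable_eq
  | |- computable _ (fun x => @?f x && @?g x) => apply: computable_andb
  | |- computable _ (fun x => @?f x || @?g x) => apply: computable_orb
  | |- computable _ (fun x => if _ then _ else _) => apply: computable_if
  end.
Ltac comp := repeat comp_step.

Section ComputableSeq.
Variable X : set nat.
Notation computable := (computable X).

Lemma size_pickle (T : countType) (s : seq T) : size s <= pickle s.
Proof.
elim: s => //= x s IHs; rewrite pickle_cons /cons_code.
apply: (@leq_trans (pickle s).*2.+1); last by rewrite leq_pmull ?expn_gt0.
by rewrite ltnS (leq_trans IHs) // -addnn leq_addr.
Qed.

(** The step [(e :: l, b) |-> (l, g b e)] stops by itself on the empty list, so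
    it may be iterated more often than needed; the code of the list is an upper
    bound for its size. *)
Lemma computable_foldl (S T U : countType) (l : S -> seq T)
    (g : S -> U -> T -> U) (f : S -> U) :
  computable l -> computable (fun p => g p.1 p.2.1 p.2.2) -> computable f ->
  computable (fun x => foldl (g x) (f x) (l x)).
Proof.
move=> compl compg compf.
pose step x (p : seq T * U) := if p.1 is e :: l' then (l', g x p.2 e) else p.
have comp_step : computable (fun p => step p.1 p.2).
  apply: (computable_case (l := fun p => p.2.1) (f := fun p => p.2)
    (g := fun p e l' => (l', g p.1 p.2.2 e))).
  - by comp.
  - by comp.
  apply: computable_pair; first by comp.
  apply: (computable_comp (f := fun q => (q.1.1, (q.1.2.2, q.2.1))) compg).
  by comp.
have /computable_ext : computable (fun x =>
    (iter (pickle (l x)) (step x) (l x, f x)).2).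
  apply: computable_snd; apply: computable_iter => //.
  exact: computable_pair.
apply=> x; move: (size_pickle (l x)); move: (pickle (l x)) => n.
elim: n (l x) (f x) => [|n IHn] [|e s] b //= szs; rewrite -iterS iterSr.
  by rewrite {2}/step /= IHn.
by rewrite IHn.
Qed.


Lemma computable_rev (S T : countType) (l : S -> seq T) :
  computable l -> computable (fun x => rev (l x)).
Proof.
move=> compl.
have /computable_ext : computable (fun x => foldl (fun s e => e :: s) [::] (l x)).
  by apply: computable_foldl => //; comp.
by apply=> x; rewrite /rev; elim: (l x) [::] => //= e s IHs acc; rewrite IHs.
Qed.

Lemma computable_foldr (S T U : countType) (l : S -> seq T) (g : S -> T -> U ->
  U) (f : S -> U) :
  computable l -> computable (fun p => g p.1 p.2.1 p.2.2) -> computable f ->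
  computable (fun x => foldr (g x) (f x) (l x)).
Proof.
move=> compl compg compf.
have /computable_ext : computable (fun x =>
    foldl (fun b e => g x e b) (f x) (rev (l x))).
  apply: (computable_foldl (g := fun x b e => g x e b)) => //.
    exact: computable_rev.
  apply: (computable_comp (f := fun q => (q.1, (q.2.2, q.2.1))) compg).
  by comp.
by apply=> x; rewrite foldl_rev.
Qed.

Section Maps.
Variables S T U : countType.

Lemma computable_map (l : S -> seq T) (g : S -> T -> U) :
  computable l -> computable (fun p => g p.1 p.2) ->
  computable (fun x => [seq g x e | e <- l x]).
Proof.
move=> compl compg.
have /computable_ext : computable (fun x =>
    foldr (fun e s => g x e :: s) [::] (l x)).
  apply: (computable_foldr (g := fun x e s => g x e :: s)) => //; comp.
  apply: (computable_comp (f := fun q => (q.1, q.2.1)) compg); comp.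
by apply=> x; elim: (l x) => //= e s ->.
Qed.

Lemma computable_filter (l : S -> seq T) (g : S -> T -> bool) :
  computable l -> computable (fun p => g p.1 p.2) ->
  computable (fun x => [seq e <- l x | g x e]).
Proof.
move=> compl compg.
have /computable_ext : computable (fun x =>
    foldr (fun e s => if g x e then e :: s else s) [::] (l x)).
  apply: (computable_foldr (g := fun x e s => if g x e then e :: s else s)) =>
    //; comp.
  apply: (computable_comp (f := fun q => (q.1, q.2.1)) compg); comp.
by apply=> x; elim: (l x) => //= e s ->.
Qed.

Lemma computable_cat (f g : S -> seq T) :
  computable f -> computable g -> computable (fun x => f x ++ g x).
Proof.
move=> compf compg.
have /computable_ext : computable (fun x => foldr cons (g x) (f x)).
  by apply: (computable_foldr (g := fun _ e s => e :: s)) => //; comp.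
by apply=> x; elim: (f x) => //= e s ->.
Qed.

Lemma computable_has (l : S -> seq T) (g : S -> T -> bool) :
  computable l -> computable (fun p => g p.1 p.2) ->
  computable (fun x => has (g x) (l x)).
Proof.
move=> compl compg.
have /computable_ext : computable (fun x =>
    foldr (fun e s => g x e || s) false (l x)).
  apply: (computable_foldr (g := fun x e s => g x e || s)) => //; comp.
  apply: (computable_comp (f := fun q => (q.1, q.2.1)) compg); comp.
by apply=> x; elim: (l x) => //= e s ->.
Qed.

Lemma computable_size (l : S -> seq T) :
  computable l -> computable (fun x => size (l x)).
Proof.
move=> compl.
have /computable_ext : computable (fun x => foldr (fun _ => succn) 0 (l x)).
  by apply: (computable_foldr (g := fun _ _ => succn)) => //; comp.
by apply=> x; elim: (l x) => //= e s ->.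
Qed.

End Maps.

Lemma computable_flatten (S T : countType) (l : S -> seq (seq T)) :
  computable l -> computable (fun x => flatten (l x)).
Proof.
move=> compl.
have /computable_ext : computable (fun x => foldr cat [::] (l x)).
  apply: (computable_foldr (g := fun _ => cat)) => //; comp.
  by apply: computable_cat; comp.
by apply.
Qed.

Lemma computable_mem (S T : countType) (f : S -> T) (l : S -> seq T) :
  computable f -> computable l -> computable (fun x => f x \in l x).
Proof.
move=> compf compl.
have /computable_ext : computable (fun x => has (fun y => y == f x) (l x)).
  apply: (computable_has (g := fun x y => y == f x)) => //; comp.
  by apply: (computable_comp compf); comp.
by apply=> x; rewrite -has_pred1.
Qed.

End ComputableSeq.

(** * Decidability of codes, oracles and Turing reductions *)

Section Codes.
Variable X : set nat.
Notation computable := (computable X).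

Definition is_code (T : countType) (c : nat) : bool := `[< range (@pickle T) c >].

Lemma is_codeP (T : countType) (c : nat) :
  reflect (exists x : T, pickle x = c) (is_code T c).
Proof. by apply: (iffP (asboolP _)) => [[x _]|[x]] <-; exists x. Qed.

Definition decidable_codes (T : countType) := computable (is_code T).

Lemma decidable_codes_fin (T : finType) : decidable_codes T.
Proof.
have /computable_ext : computable (fun c => c \in [seq pickle x | x <- enum T]).
  by apply: computable_mem; comp.
apply=> c; apply/mapP/is_codeP => [[x _ ->]|[x <-]]; first by exists x.
by exists x; rewrite ?mem_enum.
Qed.

Lemma decidable_codes_nat : decidable_codes nat.
Proof.
have /computable_ext : computable (fun _ : nat => true) by comp.
by apply=> c; apply/esym/is_codeP; exists c.
Qed.

(** A number and the list of numbers that it codes have the same code. *)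
Lemma computable_decode : computable CodeSeq.decode.
Proof.
exists id; first exact: rec1_id.
by move=> c; rewrite -[LHS]CodeSeq.decodeK; congr CodeSeq.code; rewrite map_id.
Qed.

Lemma computable_negb (S : countType) (b : S -> bool) :
  computable b -> computable (fun x => ~~ b x).
Proof. by apply: computable_comp; exact: computable_fin. Qed.

Lemma decidable_codes_seq (T : countType) :
  decidable_codes T -> decidable_codes (seq T).
Proof.
move=> decT; have /computable_ext : computable (fun c =>
    ~~ has (fun a => ~~ is_code T a) (CodeSeq.decode c)).
  apply: computable_negb; apply: (computable_has (g := fun _ a => ~~ is_code T a)).
    exact: computable_decode.
  by apply: computable_negb; apply: (computable_comp decT); comp.
apply=> c; rewrite -all_predC (eq_all (a2 := is_code T)) => [|a]; last first.
  by rewrite /= negbK.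
apply/allP/is_codeP => [allT|[s <-] a].
  have [s sE] : exists s : seq T, map pickle s = CodeSeq.decode c.
    elim: (CodeSeq.decode c) allT => [|a l IHl] allT; first by exists [::].
    have /is_codeP[x <-] := allT a (mem_head _ _).
    have [|s <-] := IHl; first by move=> b bl; rewrite allT // inE bl orbT.
    by exists (x :: s).
  by exists s; rewrite -[c]CodeSeq.decodeK -sE.
by rewrite CodeSeq.codeK => /mapP[x _ ->]; apply/is_codeP; exists x.
Qed.

Lemma decidable_codes_pair (S T : countType) :
  decidable_codes S -> decidable_codes T -> decidable_codes (S * T)%type.
Proof.
move=> decS decT; have /computable_ext : computable (fun c =>
    if CodeSeq.decode c is a :: l then
      if l is b :: l' then [&& is_code S a, is_code T b & l' == [::]]
      else false
    else false).
  apply: (computable_case (f := fun=> false) (g := fun _ a l => if l is b :: l' then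
    [&& is_code S a, is_code T b & l' == [::]] else false)).
  - exact: computable_decode.
  - by comp.
  apply: (computable_case (l := fun p => p.2.2) (f := fun=> false) (g := fun p
    b l' =>
    [&& is_code S p.2.1, is_code T b & l' == [::]])).
  - by comp.
  - by comp.
  comp; first by apply: (computable_comp decS); comp.
  by apply: (computable_comp decT); comp.
apply=> c; apply/idP/is_codeP => [|[[x y] <-]]; last first.
  have -> : pickle (x, y) = CodeSeq.code [:: pickle x; pickle y] by [].
  by rewrite CodeSeq.codeK; apply/and3P; split=> //; apply/is_codeP;
    [exists x|exists y].
rewrite -{2}[c]CodeSeq.decodeK; case: (CodeSeq.decode c) => [|a [|b l]] //.
by case/and3P=> /is_codeP[x <-] /is_codeP[y <-] /eqP ->; exists (x, y).
Qed.

Lemma decidable_codes_nfa (T : countType) :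
  decidable_codes T -> decidable_codes (nfa T).
Proof.
move=> decT.
have /computable_ext : decidable_codes (nat * seq nat * seq (nat * T * nat))%type.
  have decN := decidable_codes_nat.
  by do !apply: decidable_codes_pair => //; apply: decidable_codes_seq => //;
    do !apply: decidable_codes_pair.
apply=> c; apply/is_codeP/is_codeP => [[u <-]|[B <-]];
  last by exists (triple_of_nfa B).
by exists (nfa_of_triple u); case: u => -[].
Qed.

End Codes.

Lemma computable_oracle (T : countType) (Q : set T) :
  computable (codes Q) (fun y => `[< Q y >]).
Proof.
exists (fun c => if (if `[< codes Q c >] then 1 else 0) is 0
                 then pickle false else pickle true).
  apply: recs_if0; [|exact: recs_const..].
  have := rec_oracle (codes Q); rewrite /recs; congr recursive_in.
  by apply/funext => t; rewrite /thead (tnth_nth 0) nth0.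
move=> y; have -> : `[< codes Q (pickle y) >] = `[< Q y >].
  congr asbool; apply/propext; split=> [[z Qz]|Qy]; last by exists y.
  by move/(pcan_inj pickleK) => <-.
by case: asboolP.
Qed.

(** A characteristic function has to vanish on the numbers that code nothing,
    which is why codes have to be decidable. *)
Lemma turing_reducible_computable (S T : countType) (P : set S) (Q : set T) :
  decidable_codes (codes Q) S -> computable (codes Q) (fun x => `[< P x >]) ->
  turing_reducible P Q.
Proof.
move=> [V recV VE] [F recF FE].
have := recs_if0 (recs_eqn recV (recs_const _ 1 (pickle true))) (recs_const _ 1 0)
  (recs_eqn recF (recs_const _ 1 (pickle true))).
rewrite /recs /turing_reducible; congr recursive_in; apply/funext => t.
have -> : head 0 t = thead t by rewrite /thead (tnth_nth 0) nth0.
have {}VE c : (V c == pickle true) = is_code S c.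
  by rewrite -[c in V c]/(pickle c) VE (inj_eq (pcan_inj pickleK)) eqb_id.
rewrite VE; case: is_codeP => [[x <-]|nx]; last first.
  by case: asboolP => // -[x _ xE]; case: nx; exists x.
rewrite FE (inj_eq (pcan_inj pickleK)) eqb_id /=; congr nat_of_bool.
apply/asboolP/asboolP => [Px|[z Pz]]; first by exists x.
by move/(pcan_inj pickleK) => <-.
Qed.

(** * The automaton of a finitely generated submonoid *)

Fixpoint suffixes (T : Type) (u : seq T) : seq (T * seq T) :=
  if u is x :: u' then (x, u') :: suffixes u' else [::].

Lemma suffixesP (T : eqType) (u : seq T) x v :
  reflect (suffix (x :: v) u) ((x, v) \in suffixes u).
Proof.
elim: u => [|y u IHu] /=; first by rewrite suffixs0; exact: ReflectF.
rewrite inE; apply: (iffP orP).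
  case=> [/eqP[-> ->]|/IHu/suffixP[s ->]]; first exact: suffix_refl.
  by apply/suffixP; exists (y :: s).
case/suffixP=> -[|z s] /= [-> uE]; first by left; rewrite uE.
by right; apply/IHu/suffixP; exists s.
Qed.

Lemma computable_suffixes X (S T : countType) (l : S -> seq T) :
  computable X l -> computable X (fun x => suffixes (l x)).
Proof.
move=> compl; have /computable_ext : computable X (fun x =>
    (foldr (fun e (p : seq T * seq (T * seq T)) =>
              (e :: p.1, (e, p.1) :: p.2)) ([::], [::]) (l x)).2).
  apply: computable_snd.
  by apply: (computable_foldr (g := fun _ e (p : seq T * seq (T * seq T)) =>
              (e :: p.1, (e, p.1) :: p.2))) => //; comp.
apply=> x; elim: (l x) => //= e s ->; congr ((_, _) :: _).
by elim: s => //= e' s ->.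
Qed.

Lemma computable_NFA X (S T : countType) (i : S -> nat) (f : S -> seq nat)
    (t : S -> seq (nat * T * nat)) :
  computable X i -> computable X f -> computable X t ->
  computable X (fun x => NFA (i x) (f x) (t x)).
Proof.
move=> compi compf compt.
have [F recF FE] := computable_pair (computable_pair compi compf) compt.
by exists F.
Qed.

Section StarAutomaton.
Variable T : countType.

(** A state is the code of the word that remains to be read of the current
    generator.  The code 0 of the empty word is both the initial and the final
    state; since there are no silent moves, the first letter of the next
    generator is read directly from it. *)
Definition star_nfa (D : seq (seq T)) : nfa T :=
  NFA 0 [:: 0] (flatten [seq
    [seq (pickle (e.1 :: e.2), e.1, pickle e.2) | e <- suffixes d] ++
    (if d is a :: v then [:: (0, a, pickle v)] else [::]) | d <- D]).

Lemma star_nfa_trans D p a q : (p, a, q) \in nfa_trans (star_nfa D) <->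
  exists v d, [/\ d \in D, q = pickle v &
    p = pickle (a :: v) /\ suffix (a :: v) d \/ p = 0 /\ d = a :: v].
Proof.
split=> [/flatten_mapP[d dD]|[v [d [dD ->]]]].
  rewrite mem_cat => /orP[/mapP[[b v] /suffixesP bv [-> -> ->]]|].
    by exists v, d; split=> //; left.
  by case: d dD => // b v bvD; rewrite inE => /eqP[-> -> ->];
    exists v, (b :: v); split=> //; right.
move=> tE; apply/flatten_mapP; exists d => //; rewrite mem_cat; apply/orP.
case: tE => -[-> dE]; [left|right].
  by apply/mapP; exists (a, v) => //; apply/suffixesP.
by rewrite dE mem_head.
Qed.

Lemma star_nfa_accepts D d u w : d \in D -> suffix u d ->
  nfa_accepts_from (star_nfa D) 0 w ->
  nfa_accepts_from (star_nfa D) (pickle u) (u ++ w).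
Proof.
move=> dD + acc_w; elim: u => //= a u IHu sfx; apply/hasP.
exists (pickle (a :: u), a, pickle u); last first.
  rewrite !eqxx IHu //; case/suffixP: sfx => s ->.
  by apply/suffixP; exists (rcons s a); rewrite cat_rcons.
by apply/star_nfa_trans; exists u, d; split=> //; left.
Qed.

(** Distinct words have distinct codes, so a state determines what was left to
    read and no run can jump from one generator into another. *)
Lemma star_nfa_accepts_from D u w :
  nfa_accepts_from (star_nfa D) (pickle u) w ->
  exists2 ws, {subset ws <= D} & w = u ++ flatten ws.
Proof.
elim: w u => [|a w IHw] u /=.
  rewrite inE -[0]/(pickle ([::] : seq T)) => /eqP/(pcan_inj pickleK) ->.
  by exists [::].
case/hasP=> -[[p b] q] /star_nfa_trans[v [d [dD -> pE]]] /=.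
case/and3P=> /eqP eq_p /eqP eq_b /IHw[ws subD ->].
rewrite {}eq_p {}eq_b in pE; case: pE => [[/(pcan_inj pickleK) -> _]|].
  by exists ws.
rewrite -[0]/(pickle ([::] : seq T)) => -[/(pcan_inj pickleK) -> dE].
exists (d :: ws); last by rewrite dE.
by move=> x; rewrite inE => /predU1P[->|/subD].
Qed.

Lemma nfa_lang_star D : nfa_lang (star_nfa D) = star (fun u => u \in D).
Proof.
apply/seteqP; split=> w /=.
  by case/(@star_nfa_accepts_from _ [::]) => ws subD ->; exists ws.
case=> ws /= + <-; rewrite /nfa_lang /=; elim: ws => // d ws IHws subD.
have dD := subD d (mem_head _ _).
have {IHws} acc : nfa_accepts_from (star_nfa D) 0 (flatten ws).
  by apply: IHws => x x_ws; apply: subD; rewrite inE x_ws orbT.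
case: d {subD} dD => [|a v] //= avD; apply/hasP; exists (0, a, pickle v).
  by apply/star_nfa_trans; exists v, (a :: v); split=> //; right.
rewrite !eqxx /=; apply: star_nfa_accepts avD _ acc.
by apply/suffixP; exists [:: a].
Qed.

Lemma computable_star_nfa X : computable X star_nfa.
Proof.
apply: computable_NFA; comp; apply: computable_flatten.
apply: (computable_map (g := fun _ d =>
  [seq (pickle (e.1 :: e.2), e.1, pickle e.2) | e <- suffixes d] ++
    (if d is a :: v then [:: (0, a, pickle v)] else [::]))); comp.
apply: computable_cat.
  apply: (computable_map (g := fun _ e => (pickle (e.1 :: e.2), e.1, pickle e.2))).
    by apply: computable_suffixes; comp.
  by comp; apply: computable_pickle; comp.
apply: (computable_case (g := fun _ a v => [:: (0, a, pickle v)])); comp.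
by apply: computable_pickle; comp.
Qed.

End StarAutomaton.

Lemma submonoid_reducible_rational (K : groupType) (n : nat) (s : 'I_n -> K) :
  turing_reducible (submonoid_membership s) (rational_subset_membership s).
Proof.
apply: turing_reducible_computable.
  apply: decidable_codes_pair; do ?apply: decidable_codes_seq;
    do ?apply: decidable_codes_fin; apply: decidable_codes_pair;
      exact: decidable_codes_fin.
have /computable_ext : computable (codes (rational_subset_membership s))
    (fun I : seq (word n) * word n =>
       `[< rational_subset_membership s (star_nfa I.1, I.2) >]).
  apply: (computable_comp (computable_oracle _)).
  comp; apply: (computable_comp (computable_star_nfa _ _)); comp.
apply=> I; congr asbool; rewrite /rational_subset_membership /=.
by rewrite nfa_lang_star.
Qed.

(** * The action of a factor on normal forms *)

Local Open Scope classical_set_scope.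
Local Open Scope group_scope.

Section Morphisms.
Variables (G H : groupType) (f : {multiplicative G -> H}).

Lemma multiplicative1 : f 1 = 1.
Proof. by apply: (mulIg (f 1)); rewrite -gmulfM !mul1g. Qed.

Lemma multiplicativeV x : f x^-1 = (f x)^-1.
Proof. by apply: (mulIg (f x)); rewrite -gmulfM !mulVg multiplicative1. Qed.

End Morphisms.

(** The symmetric group of a possibly infinite type. *)
Record bijection (T : Type) := Bijection {
  bij_fun :> T -> T;
  bij_inv : T -> T;
  bij_funK : cancel bij_fun bij_inv;
  bij_invK : cancel bij_inv bij_fun
}.

Section BijectionGroup.
Variable T : Type.
Implicit Types f g : bijection T.

Lemma bijection_eq f g : f =1 g -> f = g.
Proof.
case: f g => [f f' fK f'K] [g g' gK g'K] /= /funext eq_fg; subst g.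
have eq_inv : g' = f' by apply/funext => x; rewrite -[x in LHS]f'K gK.
by subst g'; congr Bijection; exact: Prop_irrelevance.
Qed.

Definition bij_one : bijection T := @Bijection T id id (fun=> erefl) (fun=> erefl).

Definition bij_mul f g : bijection T :=
  Bijection (can_comp (@bij_funK _ f) (@bij_funK _ g))
            (can_comp (@bij_invK _ g) (@bij_invK _ f)).

Definition bij_opp f : bijection T := Bijection (@bij_invK _ f) (@bij_funK _ f).

HB.instance Definition _ := gen_eqMixin (bijection T).
HB.instance Definition _ := gen_choiceMixin (bijection T).

Fact bij_mulA : associative bij_mul.
Proof. by move=> f g h; apply: bijection_eq. Qed.
Fact bij_mul1 : left_id bij_one bij_mul.
Proof. by move=> f; apply: bijection_eq. Qed.
Fact bij_1mul : right_id bij_one bij_mul.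
Proof. by move=> f; apply: bijection_eq. Qed.
Fact bij_mulV : left_inverse bij_one bij_opp bij_mul.
Proof. by move=> f; apply: bijection_eq => x /=; rewrite bij_funK. Qed.
Fact bij_Vmul : right_inverse bij_one bij_opp bij_mul.
Proof. by move=> f; apply: bijection_eq => x /=; rewrite bij_invK. Qed.

HB.instance Definition _ := isGroup.Build (bijection T)
  bij_mulA bij_mul1 bij_1mul bij_mulV bij_Vmul.

End BijectionGroup.

Section FactorAction.
Variables (A G : groupType) (j : {multiplicative A -> G}) (j_inj : injective j).
Variables (T : Type) (letter : G -> T) (value : T -> option G).
Hypothesis letterK : pcancel letter value.
Hypothesis valueK : ocancel value letter.

(** The representative of the coset [A x], chosen to be 1 for [A] itself. *)
Definition coset_rep (x : G) : G :=
  if `[< range j x >] then 1 else xget 1 [set y | exists a, y = j a * x].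

Lemma coset_repM a x : coset_rep (j a * x) = coset_rep x.
Proof.
rewrite /coset_rep; have -> : range j (j a * x) = range j x.
  apply/propext; split=> -[b _ bE]; last by exists (a * b); rewrite // gmulfM bE.
  by exists (a^-1 * b); rewrite // gmulfM bE multiplicativeV mulKg.
case: ifP => // _; congr xget; apply/seteqP; split=> y [b ->].
  by exists (b * a); rewrite gmulfM mulgA.
by exists (b * a^-1); rewrite gmulfM multiplicativeV mulgA mulgKV.
Qed.

Lemma coset_repP x : exists a, x = j a * coset_rep x.
Proof.
rewrite /coset_rep; case: asboolP => [[a _ <-]|_]; first by exists a; rewrite mulg1.
case: xgetP => [y _ [a ->]|/(_ x) []]; first by exists a^-1;
  rewrite multiplicativeV mulKg.
by exists 1; rewrite multiplicative1 mul1g.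
Qed.

Lemma coset_rep_eq1 x : coset_rep x = 1 <-> range j x.
Proof.
split=> [x1|jx]; last by rewrite /coset_rep; case: asboolP.
by have [a ->] := coset_repP x; rewrite x1 mulg1; exists a.
Qed.

Lemma coset_rep_id x : coset_rep (coset_rep x) = coset_rep x.
Proof. by have [a {2}->] := coset_repP x; rewrite coset_repM. Qed.

Definition coset_part (x : G) : A := projT1 (cid (coset_repP x)).

Lemma coset_partP x : x = j (coset_part x) * coset_rep x.
Proof. by rewrite /coset_part; case: cid. Qed.

Lemma coset_partM a x : coset_rep x = x -> coset_part (j a * x) = a.
Proof.
move=> xE; apply: j_inj; have := coset_partP (j a * x).
by rewrite coset_repM xE => /mulIg.
Qed.

(** The nontrivial coset representatives, that is, the admissible syllables. *)
Definition transversal (x : G) : bool := (coset_rep x == x) && (x != 1).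

(** A point [(a, w)] stands for the normal form [a w].  No condition is put on
    [w]: a list counts as starting with a syllable of [G] if its head is one and
    its tail does not start with one in turn.  On alternating lists this is the
    usual notion, and on all lists it makes [unfold_point] a bijection onto the
    pairs of an element of [G] and a list that does not start in [G].  On such
    pairs [G] acts by multiplication. *)
Fixpoint starts (w : seq T) : bool :=
  if w is t :: w' then
    if value t is Some x then transversal x && ~~ starts w' else false
  else false.

Definition unfold_point (p : A * seq T) : G * seq T :=
  if p.2 is t :: w then
    if value t is Some x then
      if transversal x && ~~ starts w then (j p.1 * x, w) else (j p.1, p.2)
    else (j p.1, p.2)
  else (j p.1, p.2).

Definition fold_point (q : G * seq T) : A * seq T :=
  (coset_part q.1,
   if coset_rep q.1 == 1 then q.2 else letter (coset_rep q.1) :: q.2).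

Lemma unfold_point_starts p : ~~ starts (unfold_point p).2.
Proof.
case: p => a [|t w] //=; rewrite /unfold_point /=; case vt: (value t) => [x|] /=.
  by case: ifP => [/andP[] //|H] /=; rewrite vt H.
by rewrite vt.
Qed.

Lemma unfold_point_id a w : ~~ starts w -> unfold_point (a, w) = (j a, w).
Proof.
case: w => //= t w; rewrite /unfold_point /=.
by case: (value t) => // x /negPf ->.
Qed.

Lemma starts_letter x w : coset_rep x != 1 -> ~~ starts w ->
  starts (letter (coset_rep x) :: w).
Proof. by move=> nx nw;
  rewrite /= letterK /transversal coset_rep_id eqxx nx nw. Qed.

Lemma fold_pointK q : ~~ starts q.2 -> unfold_point (fold_point q) = q.
Proof.
case: q => x w /= nw; rewrite /fold_point /=; have xE := coset_partP x.
case: eqP => [x1|/eqP nx]; first by rewrite unfold_point_id // [in RHS]xE x1 mulg1.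
have := starts_letter nx nw; rewrite /unfold_point /= letterK => ->.
by rewrite -xE.
Qed.

Lemma unfold_pointK : cancel unfold_point fold_point.
Proof.
case=> a w; rewrite /unfold_point /=.
have fold1 v : fold_point (j a, v) = (a, v).
  rewrite /fold_point /= -[j a]mulg1 coset_repM coset_partM.
    by rewrite (coset_rep_eq1 1).2 ?eqxx //; exists 1; rewrite ?multiplicative1.
  by apply/coset_rep_eq1; exists 1; rewrite ?multiplicative1.
case: w => [|t w] //; case vt: (value t) => [x|] //; case: ifP => // /andP[].
case/andP=> /eqP xE nx1 _; rewrite /fold_point /= coset_repM coset_partM // xE.
by rewrite (negPf nx1); have := valueK t; rewrite vt /= => ->.
Qed.

Definition factor_act (x : G) (p : A * seq T) : A * seq T :=
  fold_point (x * (unfold_point p).1, (unfold_point p).2).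

Lemma factor_act1 p : factor_act 1 p = p.
Proof. by rewrite /factor_act mul1g -surjective_pairing unfold_pointK. Qed.

Lemma factor_actM x y p : factor_act (x * y) p = factor_act x (factor_act y p).
Proof.
by rewrite /factor_act fold_pointK ?unfold_point_starts //= mulgA.
Qed.

Lemma factor_act_amalgamated b p : factor_act (j b) p = (b * p.1, p.2).
Proof.
rewrite -[RHS]unfold_pointK; congr fold_point; case: p => a w.
rewrite /unfold_point /=; case: w => [|t w]; first by rewrite gmulfM.
by case: (value t) => [x|]; [case: ifP => _ |]; rewrite gmulfM ?mulgA.
Qed.

(** Multiplying by an element outside [A] prepends a syllable. *)
Lemma factor_act_starts x p : ~ range j x -> ~~ starts p.2 ->
  starts (factor_act x p).2.
Proof.
case: p => a w /= jx nw; rewrite /factor_act unfold_point_id //= /fold_point.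
have jxa : coset_rep (x * j a) != 1.
  apply/eqP => /coset_rep_eq1[b _ bE]; apply: jx; exists (b * a^-1) => //.
  by rewrite gmulfM multiplicativeV bE mulgK.
by rewrite /= (negPf jxa); exact: starts_letter.
Qed.

Lemma factor_actK x : cancel (factor_act x) (factor_act x^-1).
Proof. by move=> p; rewrite -factor_actM mulVg factor_act1. Qed.
Lemma factor_actVK x : cancel (factor_act x^-1) (factor_act x).
Proof. by move=> p; rewrite -factor_actM mulgV factor_act1. Qed.

Definition factor_bij (x : G) : bijection (A * seq T) :=
  Bijection (@factor_actK x) (@factor_actVK x).

Fact factor_bijM : {morph factor_bij : x y / x * y}.
Proof. by move=> x y; apply: bijection_eq => p /=; rewrite factor_actM. Qed.

HB.instance Definition _ :=
  isMultiplicative.Build G (bijection (A * seq T)) factor_bij factor_bijM.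

End FactorAction.

(** * Ping-pong for an amalgamated free product *)

(** What normal forms are used for: [pp_region true] and [pp_region false] are the
    points whose normal form starts with a syllable of the respective factor. *)
Record ping_pong (K : groupType) (F : bool -> set K) (A : set K) := PingPong {
  pp_point : Type;
  pp_act :> {multiplicative K -> bijection pp_point};
  pp_region : bool -> set pp_point;
  pp_base : pp_point;
  pp_disjoint : forall s p, pp_region s p -> ~ pp_region (~~ s) p;
  pp_moves : forall s x p, F s x -> ~ A x ->
    ~ pp_region s p -> pp_region s (pp_act x p);
  pp_baseA : forall s x, A x -> ~ pp_region s (pp_act x pp_base)
}.

Section Subgroup.
Variables (K : groupType) (N : pred K).
Hypothesis Nclosed : group_closed N.

Definition subgroup_of of group_closed N := {x | N x}.
Local Notation S := (subgroup_of Nclosed).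

HB.instance Definition _ := SubChoice.on S.
HB.instance Definition _ := SubChoice_isSubGroup.Build K N S Nclosed.

End Subgroup.

Section Amalgam.
Variables (A G H K : groupType).
Variables (jG : {multiplicative A -> G}) (jH : {multiplicative A -> H}).
Variables (iG : {multiplicative G -> K}) (iH : {multiplicative H -> K}).
Hypotheses (jG_inj : injective jG) (jH_inj : injective jH).
Hypothesis K_amalgam : is_amalgam jG jH iG iH.

Definition factor (s : bool) : set K := if s then range iG else range iH.
Definition amalgamated : set K := range (fun a => iG (jG a)).

Let T : Type := (G + H)%type.
Let valueG (t : T) := if t is inl x then Some x else None.
Let valueH (t : T) := if t is inr y then Some y else None.

Let inlK : pcancel (@inl G H) valueG. Proof. by []. Qed.
Let inrK : pcancel (@inr G H) valueH. Proof. by []. Qed.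
Let valueGK : ocancel valueG (@inl G H). Proof. by case. Qed.
Let valueHK : ocancel valueH (@inr G H). Proof. by case. Qed.

Let actG := factor_bij jG_inj inlK valueGK.
Let actH := factor_bij jH_inj inrK valueHK.

(** Both factors let [A] act by multiplication on the first component, so their
    actions extend to [K]. *)
Lemma amalgam_action : exists u : {multiplicative K -> bijection (A * seq T)},
  [/\ forall x, u (iG x) = actG x, forall y, u (iH y) = actH y &
      forall a p, u (iG (jG a)) p = (a * p.1, p.2)].
Proof.
have [_ univ] := K_amalgam.
have [|[u [uG uH]] _] := univ _ actG actH; last first.
  by exists u; split=> // a p; rewrite uG /= factor_act_amalgamated.
by move=> a; apply: bijection_eq => p; rewrite /= !factor_act_amalgamated.
Qed.

Lemma amalgam_jE a : iG (jG a) = iH (jH a).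
Proof. by case: K_amalgam. Qed.

Lemma amalgam_ping_pong : ping_pong factor amalgamated.
Proof.
have [u [uG uH uA]] := cid amalgam_action.
pose region s (p : A * seq T) := if s then starts jG valueG p.2
                                 else starts jH valueH p.2.
apply: (@PingPong _ _ _ _ u region (1, [::])).
- by move=> [] [a [|[x|y] w]].
- move=> [] x p [z _ <-] nAz nreg.
    rewrite /region uG /=; apply: factor_act_starts => //; last exact/negP.
    by case=> a _ aE; apply: nAz; exists a; rewrite ?aE.
  rewrite /region uH /=; apply: factor_act_starts => //; last exact/negP.
  by case=> a _ aE; apply: nAz; exists a; rewrite ?amalgam_jE ?aE.
- by move=> [] _ [a _ <-]; rewrite uA.
Qed.

Lemma amalgamatedG x : amalgamated (iG x) -> range jG x.
Proof.
have [u [uG _ uA]] := amalgam_action; case=> a _ aE; apply: contrapT => nx.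
have := @factor_act_starts _ _ jG _ _ _ inlK x (1, [::]) nx isT.
have -> : factor_act jG inl valueG x (1, [::]) = u (iG x) (1, [::]) by rewrite uG.
by rewrite -aE uA.
Qed.

Lemma amalgamatedH y : amalgamated (iH y) -> range jH y.
Proof.
have [u [_ uH uA]] := amalgam_action; case=> a _ aE; apply: contrapT => ny.
have := @factor_act_starts _ _ jH _ _ _ inrK y (1, [::]) ny isT.
have -> : factor_act jH inr valueH y (1, [::]) = u (iH y) (1, [::]) by rewrite uH.
by rewrite -aE uA.
Qed.

Lemma amalgamated_factor s x : amalgamated x -> factor s x.
Proof. by case: s => -[a _ <-]; [exists (jG a) | exists (jH a);
  rewrite ?amalgam_jE]. Qed.

(** The elements of the subgroup generated by the two factors. *)
Definition factor_prod : pred K := fun z => `[< exists2 l : seq K,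
  (forall x, x \in l -> exists s, factor s x) & z = \prod_(x <- l) x >].

Lemma factor_prodM x y : factor_prod x -> factor_prod y -> factor_prod (x * y).
Proof.
move=> /asboolP[l lP ->] /asboolP[l' lP' ->]; apply/asboolP.
exists (l ++ l'); last by rewrite big_cat.
by move=> z; rewrite mem_cat => /orP[/lP|/lP'].
Qed.

Lemma factorV s x : factor s x -> factor s x^-1.
Proof. by case: s => -[y _ <-]; exists y^-1; rewrite ?multiplicativeV. Qed.

Lemma factor_prod1 s x : factor s x -> factor_prod x.
Proof.
move=> sx; apply/asboolP; exists [:: x]; last by rewrite big_seq1.
by move=> y; rewrite inE => /eqP ->; exists s.
Qed.

Lemma factor_prod_closed : group_closed factor_prod.
Proof.
have one : factor_prod 1 by apply/asboolP; exists [::]; rewrite ?big_nil.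
split=> // x y xP /asboolP[l lP yE]; apply: factor_prodM => //.
rewrite {y}yE; elim: l lP => [|y l IHl] lP; first by rewrite big_nil invg1.
rewrite big_cons invMg; apply: factor_prodM.
  by apply: IHl => z zl; apply: lP; rewrite inE zl orbT.
have [s sy] := lP y (mem_head _ _); exact: factor_prod1 (factorV sy).
Qed.

Let N := subgroup_of factor_prod_closed.

Fact iG_prod x : factor_prod (iG x).
Proof. by apply: (@factor_prod1 true); exists x. Qed.
Fact iH_prod x : factor_prod (iH x).
Proof. by apply: (@factor_prod1 false); exists x. Qed.

Definition iGN (x : G) : N := exist _ (iG x) (iG_prod x).
Definition iHN (y : H) : N := exist _ (iH y) (iH_prod y).
Fact iGN_M : {morph iGN : x y / x * y}.
Proof. by move=> x y; apply: val_inj; rewrite valM /= gmulfM. Qed.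
Fact iHN_M : {morph iHN : x y / x * y}.
Proof. by move=> x y; apply: val_inj; rewrite valM /= gmulfM. Qed.
HB.instance Definition _ := isMultiplicative.Build G N iGN iGN_M.
HB.instance Definition _ := isMultiplicative.Build H N iHN iHN_M.

(** The factors map to the subgroup [N] that they generate, hence so does [K];
    followed by the inclusion this is the identity on both factors, hence
    everywhere. *)
Lemma amalgam_generated z : factor_prod z.
Proof.
have [_ univ] := K_amalgam.
have [|[u [uG uH]] _] := univ N iGN iHN.
  by move=> a; apply: val_inj; rewrite /= amalgam_jE.
have [_ uniq_u] := univ K iG iH amalgam_jE.
have <- : val (u z) = z; last exact: valP.
apply: (uniq_u (\val \o u) idfun) => [x|y] /=; first by rewrite uG.
by rewrite uH.
Qed.

End Amalgam.

(** * Paths labelled in a ping-pong group *)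

Inductive labelled_path (Q : Type) (K : groupType) (R : Q -> K -> Q -> Prop) :
    Q -> K -> Q -> Prop :=
| path_nil p : labelled_path R p 1 p
| path_cons p x q z r :
    R p x q -> labelled_path R q z r -> labelled_path R p (x * z) r.

Section LabelledPath.
Variables (Q : Type) (K : groupType) (R : Q -> K -> Q -> Prop).

Lemma path1 p x q : R p x q -> labelled_path R p x q.
Proof. by move=> Rx; rewrite -[x]mulg1; apply: path_cons Rx _; exact: path_nil. Qed.

Lemma path_cat p y q z r :
  labelled_path R p y q -> labelled_path R q z r -> labelled_path R p (y * z) r.
Proof.
elim=> [p'|p' x q' y' r' Rx _ IH] zP; first by rewrite mul1g.
by rewrite -mulgA; apply: path_cons Rx (IH zP).
Qed.

Lemma path_closed (F : set K) p z q : F 1 -> (forall x y, F x -> F y -> F (x *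
  y)) ->
  (forall p x q, R p x q -> F x) -> labelled_path R p z q -> F z.
Proof. by move=> F1 FM RF; elim=> // p' x q' y r' /RF Fx _; exact: FM. Qed.

End LabelledPath.

Lemma path_sub (Q : Type) (K : groupType) (R R' : Q -> K -> Q -> Prop) p z q :
  (forall p x q, R p x q -> labelled_path R' p x q) ->
  labelled_path R p z q -> labelled_path R' p z q.
Proof.
move=> subR; elim=> [p'|p' x q' y' r' /subR Rx _ IH]; first exact: path_nil.
exact: path_cat Rx IH.
Qed.


Lemma neq_bool (s t : bool) : s != t -> s = ~~ t.
Proof. by case: s t => [] []. Qed.

Section PingPong.
Variables (K : groupType) (F : bool -> set K) (A : set K) (P : ping_pong F A).
Hypotheses (A1 : A 1) (AV : forall x, A x -> A x^-1)
  (AM : forall x y, A x -> A y -> A (x * y)).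

Local Notation region := (@pp_region _ _ _ P).
Local Notation base := (@pp_base _ _ _ P).
Local Notation act := (@pp_act _ _ _ P).

Lemma actM x y p : act (x * y) p = act x (act y p).
Proof. by rewrite gmulfM. Qed.

Lemma act1 p : act 1 p = p.
Proof. by rewrite multiplicative1. Qed.

Lemma baseP s : ~ region s base.
Proof. by rewrite -[base]act1; exact: pp_baseA. Qed.

Lemma A_mulr a x : A a -> A (a * x) -> A x.
Proof. by move=> /AV Aa /(AM Aa); rewrite mulKg. Qed.

Section Saturation.
Variables (Q : Type) (R : Q -> K -> Q -> Prop) (C : bool -> Q -> K -> Q -> Prop).
Hypotheses (C_factor : forall s p x q, C s p x q -> F s x)
  (C_trans : forall s p x q y r, C s p x q -> C s q y r -> C s p (x * y) r)
  (C_switch : forall s p x q, C s p x q -> A x -> C (~~ s) p x q)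
  (R_sub : forall p x q, R p x q -> exists s, C s p x q).

Section Target.
Variable r : Q.
Hypothesis C_refl : forall s, C s r 1 r.

(** [alternating s p z]: [z] labels a path from [p] to [r] made of relations
    [C s], [C (~~ s)], [C s], and so on, each of them with a label outside [A]. *)
Inductive alternating : bool -> Q -> K -> Prop :=
| alternating1 s p x : C s p x r -> ~ A x -> alternating s p x
| alternating_cons s p x q z : C s p x q -> ~ A x ->
    alternating (~~ s) q z -> alternating s p (x * z).

(** Each syllable moves the base point into the region of its own factor. *)
Lemma alternating_region s p z : alternating s p z -> region s (act z base).
Proof.
elim=> {s p z} [s p x /C_factor Fx nAx|s p x q z /C_factor Fx nAx _ IH].
  by apply: pp_moves => //; exact: baseP.
rewrite actM; apply: pp_moves => // /pp_disjoint; exact.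
Qed.

Lemma alternating_notin s p z : alternating s p z -> ~ A z.
Proof. by move=> /alternating_region regz /pp_baseA; apply; exact: regz. Qed.

(** A label in [A] is absorbed by the first syllable, which stays outside [A]. *)
Lemma alternating_absorb s p a q z :
  C s p a q -> A a -> alternating s q z -> alternating s p (a * z).
Proof.
move=> Ca Aa alt; case: alt Ca => {s q z} [s q x Cx nAx|s q x r' z Cx nAx alt] Ca.
  by apply: alternating1; [exact: C_trans Ca Cx | move=> /(A_mulr Aa)].
rewrite mulgA; apply: alternating_cons alt; first exact: C_trans Ca Cx.
by move/(A_mulr Aa).
Qed.

Lemma alternating_prepend s p x q z : C s p x q ->
  (A z /\ (forall t, C t q z r)) \/ (exists t, alternating t q z) ->
  (A (x * z) /\ (forall t, C t p (x * z) r)) \/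
  (exists t, alternating t p (x * z)).
Proof.
have both t p' y : C t p' y r -> A y -> A y /\ (forall t', C t' p' y r).
  move=> Cy Ay; split=> // t'; have [-> //|/neq_bool ->] := eqVneq t' t.
  exact: C_switch.
move=> Cx [[Az Cz]|[t alt]].
  have Cxz := C_trans Cx (Cz s).
  have [Axz|nAxz] := pselect (A (x * z)); first by left; exact: both Cxz Axz.
  by right; exists s; exact: alternating1.
have [eq_ts|ne_ts] := eqVneq t s; last first.
  rewrite (neq_bool ne_ts) {ne_ts t} in alt *.
  right; have [Ax|nAx] := pselect (A x); last by exists s;
    exact: alternating_cons Cx nAx alt.
  by exists (~~ s); apply: alternating_absorb alt => //; exact: C_switch.
rewrite {}eq_ts {t} in alt *; move: Cx.
case: alt => {s q z} [s q y Cy nAy|s q y q' z Cy nAy alt] Cx;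
  have Cxy := C_trans Cx Cy.
  have [Axy|nAxy] := pselect (A (x * y)); first by left; exact: both Cxy Axy.
  by right; exists s; exact: alternating1.
right; rewrite mulgA; have [Axy|nAxy] := pselect (A (x * y)).
  by exists (~~ s); apply: alternating_absorb alt => //; exact: C_switch.
by exists s; exact: alternating_cons alt.
Qed.

End Target.

(** [C s] stands for the paths inside the factor [s], including the recorded
    edges; [C_switch] says that the paths labelled in [A] are recorded, so that
    both factors may use them.  Then prepending an edge to a path keeps it
    either recorded or alternating, and an alternating path has its label
    outside [A]. *)
Theorem amalgamated_path_closed p z r s : (forall s, C s r 1 r) ->
  labelled_path R p z r -> A z -> C s p z r.
Proof.
move=> C_refl Rz; have : (A z /\ (forall t, C t p z r)) \/
    (exists t, alternating r t p z).
  elim: Rz C_refl => {p z r} [p|p x q z r Rx _ IH] C_refl; first by left.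
  by have [t Cx] := R_sub Rx; apply: alternating_prepend Cx (IH _).
by case=> [[_ Cz] _|[t /alternating_notin]].
Qed.

End Saturation.

Section Encoding.
Hypotheses (AF : forall s, A `<=` F s) (F1 : forall s, F s 1)
  (FV : forall s x, F s x -> F s x^-1)
  (FM : forall s x y, F s x -> F s y -> F s (x * y)).
(** The elements [u] and [v] distinguish states, and [star s] separates the
    labels in the factor [s] from the code. *)
Variables (d : bool) (u v : K) (star : bool -> K).
Hypotheses (Fu : F d u) (nAu : ~ A u) (Fv : F d v) (nAv : ~ A v)
  (nAuv : ~ A (u * v^-1)).
Hypotheses (F_star : forall s, F s (star s)) (nA_star : forall s, ~ A (star s))
  (star_conj : forall s a, A a -> a <> 1 -> ~ A (a ^ star s)).

(** The ping-pong content of: [z] is a reduced product that starts in [s] and ends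
    in [t]. *)
Definition moves s t (z : K) := forall p, ~ region t p -> region s (act z p).

Lemma moves_factor s x : F s x -> ~ A x -> moves s s x.
Proof. by move=> Fx nAx p; exact: pp_moves. Qed.

Lemma moves_comp s t r x y : moves s t x -> moves (~~ t) r y -> moves s r (x * y).
Proof.
move=> mx my p /my rp; rewrite actM; apply: mx => /pp_disjoint; exact.
Qed.

Lemma moves_compN s t r x y : moves s (~~ t) x -> moves t r y -> moves s r (x * y).
Proof. by rewrite -{2}[t]negbK; exact: moves_comp. Qed.

Lemma nAV x : ~ A x -> ~ A x^-1.
Proof. by move=> nAx /AV; rewrite invgK. Qed.

Lemma moves_star t : moves t t (star t).
Proof. by apply: moves_factor; [exact: F_star | exact: nA_star]. Qed.

Lemma moves_starV t : moves t t (star t)^-1.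
Proof. by apply: moves_factor; [exact/FV/F_star | exact/nAV/nA_star]. Qed.

Let h := star (~~ d).

(** Two left codes with different indices share a prefix and then differ, one
    continuing with [v^-1] and the other with [u^-1]; so in their quotient the
    syllable [u * v^-1] or its inverse remains.  Right codes differ in
    the same way at their ends. *)
Fixpoint left_code q := if q is q'.+1 then v^-1 * h * left_code q' else u^-1.
Fixpoint right_code q := if q is q'.+1 then right_code q' * h * u else v.

Let mh : moves (~~ d) (~~ d) h. Proof. exact: moves_star. Qed.
Let mhV : moves (~~ d) (~~ d) h^-1.
Proof. exact: moves_starV. Qed.
Let mu : moves d d u. Proof. exact: moves_factor. Qed.
Let muV : moves d d u^-1.
Proof. by apply: moves_factor; [exact: FV | exact: nAV]. Qed.
Let mv : moves d d v. Proof. exact: moves_factor. Qed.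
Let mvV : moves d d v^-1.
Proof. by apply: moves_factor; [exact: FV | exact: nAV]. Qed.
Let muv : moves d d (u * v^-1).
Proof. by apply: moves_factor => //; apply: FM => //; exact: FV. Qed.
Let mvu : moves d d (v * u^-1).
Proof.
rewrite -[v]invgK -invMg; apply: moves_factor; last exact: nAV.
by apply/FV/FM => //; exact: FV.
Qed.

Lemma moves_left q : moves d d (left_code q).
Proof.
elim: q => //= q IHq; apply: moves_compN IHq.
exact: moves_comp mvV mh.
Qed.

Lemma moves_leftV q : moves d d (left_code q)^-1.
Proof.
elim: q => [|q IHq] /=; first by rewrite invgK.
rewrite !invMg invgK; apply: (moves_comp IHq).
exact: moves_compN mhV mv.
Qed.

Lemma moves_right q : moves d d (right_code q).
Proof.
elim: q => //= q IHq; apply: moves_compN mu.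
exact: moves_comp IHq mh.
Qed.

Lemma moves_rightV q : moves d d (right_code q)^-1.
Proof.
elim: q => [|q IHq] //=; rewrite !invMg; apply: (moves_comp muV).
exact: moves_compN mhV IHq.
Qed.

Lemma moves_left_quotient p q : p <> q ->
  moves d d ((left_code p)^-1 * left_code q).
Proof.
elim: p q => [|p IHp] [|q] //= ne_pq; last 1 first.
- rewrite invMg mulgA mulgKV; apply: IHp => eq_pq; exact/ne_pq/congr1.
- rewrite invgK !mulgA; apply: moves_compN (moves_left q).
  exact: moves_comp muv mh.
rewrite !invMg invgK -!mulgA; apply: (moves_comp (moves_leftV p)).
exact: moves_compN mhV mvu.
Qed.

Lemma moves_right_quotient p q : p <> q ->
  moves d d (right_code p * (right_code q)^-1).
Proof.
elim: p q => [|p IHp] [|q] //= ne_pq; last 1 first.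
- rewrite !invMg -!mulgA mulKVg mulKVg; apply: IHp => eq_pq; exact/ne_pq/congr1.
- rewrite !invMg !mulgA; apply: moves_compN (moves_rightV q).
  exact: moves_comp mvu mhV.
rewrite -!mulgA; apply: (moves_comp (moves_right p)).
exact: moves_compN mh muv.
Qed.

Variable s : bool.

(** In both cases the prefix starts with [star (~~ s)]; conjugating by it turns any
    nontrivial label of the factor [s] into a reduced product, as shown in
    [moves_prefix_conj].  It ends in the factor [d], so that [h] may follow. *)
Definition prefix_code := if s == d then star (~~ d) * star d else star d.

Lemma moves_prefixV : moves d (~~ s) prefix_code^-1.
Proof.
have mV := moves_starV.
rewrite /prefix_code; case: (eqVneq s d) => [->|/neq_bool ->].
  by rewrite invMg; apply: moves_comp (mV d) (mV _).
by rewrite negbK.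
Qed.

Lemma moves_prefix_conj x : F s x -> x <> 1 -> moves d d (x ^ prefix_code).
Proof.
have mV := moves_starV.
have mS := moves_star.
move=> Fx x1; rewrite /prefix_code; case: (eqVneq s d) => [sd|/neq_bool sd].
  have [Ax|nAx] := pselect (A x); rewrite conjgM conjgE.
    apply: moves_comp (mV d) _; apply: moves_compN (mS d).
    apply: moves_factor; last exact: star_conj.
    by rewrite conjgE; do ?apply: FM => //; [exact: FV | exact: AF].
  apply: moves_comp (mV d) _; apply: moves_compN (mS d).
  rewrite conjgE; apply: moves_comp (mV _) _; apply: moves_comp (mS _).
  by rewrite negbK; rewrite sd in Fx; exact: moves_factor.
have [Ax|nAx] := pselect (A x).
  apply: moves_factor; last exact: star_conj.
  by rewrite conjgE; do ?apply: FM => //; [exact: FV | exact: AF].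
rewrite conjgE; apply: moves_comp (mV _) _; apply: moves_compN (mS _).
by rewrite sd in Fx; exact: moves_factor.
Qed.

(** The middle syllable [h] of a code is out of reach both for cancellations
    between left codes and for cancellations between right codes. *)
Definition code_head q := prefix_code * (h * left_code q).
Definition code q := code_head q * (h * right_code q).

(** The points whose normal form starts with the head of the code of [q] followed
    by a syllable of the factor [~~ d]. *)
Definition code_region q : set (pp_point P) :=
  [set p | region (~~ d) (act (code_head q)^-1 p)].

Lemma moves_quotient p q : p <> q ->
  moves (~~ d) (~~ d) ((code_head p)^-1 * (code p * (code q)^-1) * code_head q).
Proof.
move=> ne_pq; rewrite /code; move: (code_head p) (code_head q) => a b.
rewrite !invMg !mulgA mulVg mul1g mulgKV -(mulgA h).
apply: moves_compN mhV; apply: (moves_comp mh); rewrite negbK.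
exact: moves_right_quotient.
Qed.

Lemma quotient_region p q x : p <> q ->
  ~ code_region q x -> code_region p (act (code p * (code q)^-1) x).
Proof.
move=> /moves_quotient mpq /mpq; rewrite /code_region /= -!actM.
by rewrite mulgK.
Qed.

Lemma label_region p q x y : F s y -> ~ (y = 1 /\ p = q) ->
  code_region q x -> ~ code_region p (act y x).
Proof.
move=> Fy npq; rewrite /code_region /= => qx.
suff m : moves d d ((code_head p)^-1 * y * code_head q).
  move: (pp_disjoint qx); rewrite negbK => /m.
  by rewrite -!actM mulgK => /pp_disjoint.
rewrite /code_head !invMg; have [y1|y1] := pselect (y = 1).
  rewrite y1 mulg1 !mulgA mulgKV mulgKV; apply: moves_left_quotient => pq.
  exact: npq.
rewrite -!mulgA; apply: moves_comp (moves_leftV p) _; apply: (moves_comp mhV).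
rewrite negbK (mulgA y) (mulgA _^-1) -conjgE.
apply: moves_comp (moves_prefix_conj Fy y1) _.
exact: moves_compN mh (moves_left q).
Qed.

Lemma base_region q y : F s y -> ~ code_region q (act y base).
Proof.
move=> Fy; rewrite /code_region /= -actM => qy; apply: (pp_disjoint qy).
rewrite negbK /code_head !invMg -!mulgA actM; apply: moves_leftV.
move=> dx; apply: (pp_disjoint dx); rewrite actM; apply: mhV.
rewrite actM => d'x; apply: (pp_disjoint d'x); rewrite negbK.
apply: moves_prefixV => s'x; have [Ay|nAy] := pselect (A y).
  exact: pp_baseA Ay s'x.
apply: (pp_disjoint s'x); rewrite negbK; exact: (moves_factor Fy nAy (@baseP _)).
Qed.

Variables (Q : eqType) (num : Q -> nat).
Hypothesis num_inj : injective num.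
Variable R : Q -> K -> Q -> Prop.
Hypothesis R_factor : forall p x q, R p x q -> F s x.

Let c q := code (num q).

Lemma path_factor p x q : labelled_path R p x q -> F s x.
Proof. by apply: path_closed => //; exact: FM. Qed.

Section Target.
Variable f : Q.

(** Let [c q] be the code of the state [q].  In a product of generators
    [(c p)^-1 x (c q)], consecutive generators with matching states merge into
    one path, while a mismatch leaves a factor [c q (c r)^-1] with [q <> r].
    [blocked p z]: to the right of [(c p)^-1] stands such a product [z] that
    does not cancel against it, because no path before a mismatch is trivial. *)
Inductive blocked : Q -> K -> Prop :=
| blocked_path p y : labelled_path R p y f -> blocked p y
| blocked_step p y q r z : labelled_path R p y q -> ~ (y = 1 /\ p = q) ->
    q != r -> blocked r z -> blocked p (y * (c q * (c r)^-1 * z)).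

Lemma blocked_region p z : blocked p z -> ~ code_region (num p) (act z base).
Proof.
elim=> {p z} [p y /path_factor|p y q r z yP npq ne_qr _ IH].
  exact: base_region.
rewrite actM; apply: (label_region (q := num q) (path_factor yP)).
  by case=> y1 /num_inj pq; apply: npq.
rewrite actM; apply: quotient_region IH.
by move/num_inj/eqP; rewrite (negPf ne_qr).
Qed.

(** The first path is allowed to be trivial here; [normal_mismatch] deals with the
    cancellation that this may cause. *)
Inductive normal (p : Q) : K -> Prop :=
| normal_path y : labelled_path R p y f -> normal p y
| normal_step y q r z : labelled_path R p y q -> q != r -> blocked r z ->
    normal p (y * (c q * (c r)^-1 * z)).

Lemma normal_prepend p y q z : labelled_path R p y q -> normal q z ->
  normal p (y * z).
Proof.
move=> yP [z' zP|y' q' r z' yP' ne_qr rz]; first exact/normal_path/path_cat/zP.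
by rewrite mulgA; apply: normal_step => //; exact: path_cat yP'.
Qed.

(** A trivial path between two mismatches is deleted, and the mismatches around
    it merge into one, or into none if their outer states agree. *)
Lemma normal_mismatch i p z : normal p z ->
  normal i (c i * (c p)^-1 * z).
Proof.
have [<-|ne_ip] := eqVneq i p; first by rewrite mulgV mul1g.
have step w : blocked p w -> normal i (c i * (c p)^-1 * w).
  by rewrite -[X in normal i X]mul1g; exact: (normal_step (path_nil _ _)).
case=> [y yP|y q r w yP ne_qr rw]; first exact/step/blocked_path.
have [[y1 pq]|npq] := pselect (y = 1 /\ p = q); last exact/step/blocked_step.
rewrite {}y1 -{}pq {yP} in ne_qr *.
rewrite mul1g -(mulgA (c p)) (mulgA _ (c p)) mulgKV mulgA.
have [ir|ne_ir] := eqVneq i r.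
  rewrite ir mulgV mul1g;
    case: rw => {r w ne_qr ir} [r y' yP'|r y' q' r' w yP' _ ne_qr rw].
    exact: normal_path.
  exact: normal_step.
by rewrite -[X in normal i X]mul1g; exact: (normal_step (path_nil _ _)).
Qed.

(** If a mismatch remained, it would move the base point into a region that no
    element of the factor can reach. *)
Lemma normal_in_factor p z : normal p z -> F s z -> labelled_path R p z f.
Proof.
case=> // y q r w yP ne_qr rw Fz; have Fy := path_factor yP.
have Fqr : F s (c q * (c r)^-1 * w) by have := FM (FV Fy) Fz; rewrite mulKg.
case: (base_region (q := num q) Fqr); rewrite actM; apply: quotient_region.
  by move/num_inj/eqP; rewrite (negPf ne_qr).
exact: blocked_region.
Qed.

End Target.

(** Multiplied by [c i] on the left and by the inverse of [c f] on the right, the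
    product of the generators becomes a normal product, built by prepending the
    generators one at a time. *)
Theorem encoding_faithful i z f (ts : seq (Q * K * Q)) : F s z ->
  {in ts, forall t, R t.1.1 t.1.2 t.2} ->
  \prod_(t <- ts) ((c t.1.1)^-1 * t.1.2 * c t.2) = (c i)^-1 * z * c f ->
  labelled_path R i z f.
Proof.
move=> Fz tsR eq_z; apply: normal_in_factor => //.
have -> : z = c i * (\prod_(t <- ts) ((c t.1.1)^-1 * t.1.2 * c t.2) * (c f)^-1).
  by rewrite eq_z mulgK mulKVg.
elim: ts {z Fz eq_z} i tsR => [|t ts IH] i tsR.
  rewrite big_nil mul1g -[X in normal f i X]mulg1.
  exact/normal_mismatch/normal_path/path_nil.
have assoc (a b x e g h' : K) : a * (b * x * e * g * h') = a * b * (x * (e * (g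
  * h'))).
  by rewrite !mulgA.
rewrite big_cons assoc; apply: normal_mismatch.
apply: (@normal_prepend _ _ _ t.2); first exact/path1/tsR/mem_head.
by apply: IH => t' tts; apply: tsR; rewrite inE tts orbT.
Qed.

End Encoding.
End PingPong.

(** * Saturation, and spelling an instance over the factors *)

Section Saturate.
Variables (T : eqType) (C : seq T) (rule : seq T -> T -> bool).

(** [rule E e] says that [e] may be added once the elements of [E] are present. *)
Definition saturation_step (E : seq T) : seq T :=
  [seq e <- C | (e \in E) || rule E e].

Definition saturate : seq T := iter (size C) saturation_step [::].

Lemma saturate_sound (P : T -> Prop) :
  (forall E e, {in E, forall e', P e'} -> rule E e -> P e) ->
  {in saturate, forall e, P e}.
Proof.
rewrite /saturate => soundP; elim: (size C) => //= m IHm e.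
by rewrite mem_filter => /andP[/orP[/IHm|/(soundP _ _ IHm)]].
Qed.

Lemma saturate_sub : {subset saturate <= C}.
Proof.
rewrite /saturate; case: (size C) => //= m e.
by rewrite mem_filter => /andP[].
Qed.

(** The stages increase, and within [size C] steps two consecutive ones coincide,
    since each strict step adds an element of [C]. *)
Lemma saturate_closed e : e \in C -> rule saturate e -> e \in saturate.
Proof.
pose E m := iter m saturation_step [::].
have subE m : subseq (E m) (E m.+1).
  have [D ED] : exists D, E m = filter D C.
    by case: m => [|m]; [exists pred0; rewrite filter_pred0 | eexists].
  have -> : E m = [seq e <- E m.+1 | e \in E m].
    rewrite /= /saturation_step -filter_predI {1}ED; apply: eq_in_filter => x xC /=.
    by rewrite ED mem_filter xC andbT; case: (D x).
  exact: filter_subseq.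
have [m le_mC Em] : exists2 m, m <= size C & E m.+1 = E m.
  apply: contrapT => noE.
  have szE m : m <= (size C).+1 -> m <= size (E m).
    elim: m => // m IHm lt_mC; have /IHm le_m := ltnW lt_mC.
    have [le_sz eq_sz] := size_subseq_leqif (subE m).
    rewrite (leq_ltn_trans le_m) // ltn_neqAle le_sz andbT eq_sz.
    by apply/eqP => Em; apply: noE; exists m.
  have := szE _ (leqnn _); rewrite leqNgt ltnS.
  by rewrite /E /= size_filter count_size.
have satE : saturate = E m.
  rewrite /saturate -(subnK le_mC) iterD -/(E m); elim: (_ - m) => //= k ->.
  exact: Em.
rewrite satE => eC rule_e; rewrite -Em /= mem_filter eC rule_e orbT.
by [].
Qed.

End Saturate.

(** A syllable is a word whose value lies in the factor named by the boolean.
    A state is made of syllables still to be read and of the place to go once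
    they are read. *)
Notation syllable n := (bool * word n)%type.
Notation state n := (seq (syllable n) * nat)%type.
Notation transition n := (state n * syllable n * state n)%type.

Section Words.
Variables (K : groupType) (n : nat) (s : 'I_n -> K).
Local Notation ev := (Defs.eta s).

Lemma eta_nil : ev [::] = 1. Proof. exact: big_nil. Qed.

Lemma eta_cat u v : ev (u ++ v) = ev u * ev v.
Proof. exact: big_cat. Qed.

Lemma eta_cons l v : ev (l :: v) = ev [:: l] * ev v.
Proof. by rewrite -cat1s eta_cat. Qed.

Lemma eta_flatten ws : ev (flatten ws) = \prod_(w <- ws) ev w.
Proof.
elim: ws => [|w ws IHws]; first by rewrite eta_nil big_nil.
by rewrite /= eta_cat IHws big_cons.
Qed.

Definition word_inv (w : word n) : word n := rev [seq (l.1, ~~ l.2) | l <- w].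

Lemma eta_inv w : ev (word_inv w) = (ev w)^-1.
Proof.
rewrite /word_inv; elim: w => [|[i b] w IHw]; first by rewrite eta_nil invg1.
rewrite /= rev_cons -cats1 eta_cat IHw (eta_cons _ w) invMg; congr (_ * _).
by rewrite /Defs.eta !big_seq1; case: b => //=; rewrite invgK.
Qed.

Lemma computable_word_inv X : computable X word_inv.
Proof.
apply: computable_rev; apply: (computable_map (g := fun _ l => (l.1, ~~ l.2)));
  comp.
by apply: computable_negb; comp.
Qed.

Variable syllables : letter n -> seq (syllable n).

Definition value (u : seq (syllable n)) : K := \prod_(x <- u) ev x.2.

Hypothesis value_syllables : forall l, value (syllables l) = ev [:: l].

Definition word_syllables (w : word n) := flatten (map syllables w).

Lemma value_word_syllables w : value (word_syllables w) = ev w.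
Proof.
elim: w => [|l w IHw]; first by rewrite eta_nil; exact: big_nil.
rewrite eta_cons -IHw -value_syllables; exact: big_cat.
Qed.

(** The path that reads [u] and arrives at [([::], r)]. *)
Definition chain (u : seq (syllable n)) (r : nat) : seq (transition n) :=
  [seq ((e.1 :: e.2, r), e.1, (e.2, r)) | e <- suffixes u].

(** The state [p] of the automaton becomes [([::], p.+1)]; the place 0 is reached
    after the inverse of the word has been read from a final state.  Syllables
    with the empty word serve as silent moves. *)
Definition spelled (I : nfa (letter n) * word n) : seq (transition n) :=
  let W := word_syllables (word_inv I.2) in
  flatten [seq (([::], t.1.1.+1), (true, [::]), (syllables t.1.2, t.2.+1)) ::
                 chain (syllables t.1.2) t.2.+1 | t <- nfa_trans I.1] ++
  [seq (([::], f.+1), (true, [::]), (W, 0)) | f <- nfa_final I.1] ++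
  chain W 0.

Definition edge (T : seq (transition n)) (p : state n) (x : K) (q : state n) :
  Prop :=
  exists2 y, (p, y, q) \in T & x = ev y.2.

Lemma computable_chain X (S : countType) (u : S -> seq (syllable n)) (r : S ->
  nat) :
  computable X u -> computable X r -> computable X (fun x => chain (u x) (r x)).
Proof.
move=> compu compr; apply: (computable_map (g := fun x e =>
  ((e.1 :: e.2, r x), e.1, (e.2, r x)))); first exact: computable_suffixes.
by comp; apply: (computable_comp compr); comp.
Qed.

Lemma computable_nfa_trans X (T : countType) : computable X (@nfa_trans T).
Proof.
have [F recF FE] := @computable_id X (nfa T).
apply: (@computable_ext X _ _ (fun B => (triple_of_nfa B).2)) => //.
have comp3 : computable X (@triple_of_nfa T) by exists F.
by apply: computable_snd.
Qed.

Lemma computable_nfa_final X (T : countType) : computable X (@nfa_final T).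
Proof.
apply: (@computable_ext X _ _ (fun B => (triple_of_nfa B).1.2)) => //.
have [F recF FE] := @computable_id X (nfa T).
have comp3 : computable X (@triple_of_nfa T) by exists F.
by comp.
Qed.

Lemma computable_nfa_init X (T : countType) : computable X (@nfa_init T).
Proof.
apply: (@computable_ext X _ _ (fun B => (triple_of_nfa B).1.1)) => //.
have [F recF FE] := @computable_id X (nfa T).
have comp3 : computable X (@triple_of_nfa T) by exists F.
by comp.
Qed.

Lemma computable_word_syllables X : computable X word_syllables.
Proof.
apply: computable_flatten;
  apply: (computable_map (g := fun _ l => syllables l)); comp.
by apply: (computable_comp (computable_fin _ syllables)); comp.
Qed.

Lemma computable_spelled X : computable X spelled.
Proof.
have compW : computable X (fun I : nfa (letter n) * word n =>
    word_syllables (word_inv I.2)).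
  apply: (computable_comp (computable_word_syllables _)).
  by apply: (computable_comp (computable_word_inv _)); comp.
have comps (S : countType) (l : S -> letter n) : computable X l ->
    computable X (fun x => syllables (l x)).
  exact: (computable_comp (computable_fin _ syllables)).
apply: computable_cat.
  apply: computable_flatten; apply: (computable_map (g := fun _ t =>
    (([::], t.1.1.+1), (true, [::]), (syllables t.1.2, t.2.+1)) ::
                 chain (syllables t.1.2) t.2.+1)).
    by apply: (computable_comp (computable_nfa_trans _ _)); comp.
  by comp; [apply: comps; comp|apply: computable_chain; [apply: comps|]; comp].
apply: computable_cat; last by apply: computable_chain => //; comp.
apply: (computable_map (g := fun I f =>
    (([::], f.+1), (true, [::]), (word_syllables (word_inv I.2), 0)))).
  by apply: (computable_comp (computable_nfa_final _ _)); comp.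
by comp; apply: (computable_comp compW); comp.
Qed.

Section Correct.
Variable I : nfa (letter n) * word n.
Let W := word_syllables (word_inv I.2).
Let T := spelled I.

Lemma value_cons x u : value (x :: u) = ev x.2 * value u.
Proof. exact: big_cons. Qed.

Lemma spelledP t : t \in T ->
  [\/ exists p l q, (p, l, q) \in nfa_trans I.1 /\
        t = (([::], p.+1), (true, [::]), (syllables l, q.+1)),
      exists x u r, t = ((x :: u, r), x, (u, r)) |
      exists2 f, f \in nfa_final I.1 & t = (([::], f.+1), (true, [::]), (W, 0))].
Proof.
rewrite mem_cat => /orP[/flatten_mapP[[[p l] q] pq]|].
  rewrite inE => /predU1P[->|/mapP[[x u] _ ->]]; first by apply: Or31;
    exists p, l, q.
  by apply: Or32; exists x, u, q.+1.
rewrite mem_cat => /orP[/mapP[f fI ->]|/mapP[[x u] _ ->]].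
  by apply: Or33; exists f.
by apply: Or32; exists x, u, 0.
Qed.

Lemma chain_path U u r : {subset chain U r <= T} -> suffix u U ->
  labelled_path (edge T) (u, r) (value u) ([::], r).
Proof.
move=> subT; elim: u => [|x u IHu] sfx; first by rewrite /value big_nil;
  exact: path_nil.
rewrite value_cons; apply: (path_cons (q := (u, r))); last first.
  by apply: IHu; case/suffixP: sfx => v ->; apply/suffixP; exists (rcons v x);
    rewrite cat_rcons.
exists x => //; apply: subT; apply/mapP; exists (x, u) => //; exact/suffixesP.
Qed.

Lemma spelled_complete p v : nfa_accepts_from I.1 p v ->
  labelled_path (edge T) ([::], p.+1) (ev v * (ev I.2)^-1) ([::], 0).
Proof.
elim: v p => [|l v IHv] p /=.
  move=> fI; rewrite eta_nil; apply: (path_cons (q := (W, 0))).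
    exists (true, [::]); last by rewrite eta_nil.
    rewrite mem_cat; apply/orP; right; rewrite mem_cat; apply/orP; left.
    by apply/mapP; exists p.
  rewrite -eta_inv -value_word_syllables; apply: (@chain_path W) => [t tW|].
    by rewrite mem_cat; apply/orP; right; rewrite mem_cat tW orbT.
  exact: suffix_refl.
case/hasP=> -[[p' l'] q] pq /= /and3P[/eqP eq_p /eqP eq_l acc].
rewrite {}eq_p {}eq_l in pq; have subT t :
    t \in (([::], p.+1), (true, [::]), (syllables l, q.+1)) ::
          chain (syllables l) q.+1 -> t \in T.
  move=> tin; rewrite mem_cat; apply/orP; left.
  by apply/flatten_mapP; exists (p, l, q).
rewrite -[_ * _]mul1g; apply: (path_cons (q := (syllables l, q.+1))).
  by exists (true, [::]); [apply: subT; exact: mem_head | rewrite eta_nil].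
rewrite eta_cons -mulgA -value_syllables; apply: path_cat (IHv _ acc).
apply: (@chain_path (syllables l)); last exact: suffix_refl.
by move=> t tin; apply: subT; rewrite inE tin orbT.
Qed.

(** What a path from [p] to the last place spells: the pending syllables, then the
    label of an accepting run, then the inverse of the word. *)
Definition residual (p : state n) (z : K) : Prop :=
  if p.2 is q.+1 then
    exists2 v, nfa_accepts_from I.1 q v & z = value p.1 * ev v * (ev I.2)^-1
  else z = value p.1.

Lemma spelled_residual p z :
  labelled_path (edge T) p z ([::], 0) -> residual p z.
Proof.
have value_nil : value [::] = 1 by exact: big_nil.
have valueW : value W = (ev I.2)^-1 by rewrite value_word_syllables eta_inv.
move Eq : ([::], 0) => q pz;
  elim: pz Eq => {p z q} [p|p x q z r [y ypq ->] _ IH] Er.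
  by rewrite -Er /residual /= value_nil.
have {IH} := IH Er;
  case: (spelledP ypq) => [[p' [l [q' [pq]]]]|[a [u [r']]]|[f fI]] [-> -> ->].
- case=> v acc ->; exists (l :: v); last first.
    by rewrite eta_nil value_nil !mul1g eta_cons value_syllables.
  by apply/hasP; exists (p', l, q') => //=; rewrite !eqxx.
- case: r' {ypq} => [|r'] /=; first by rewrite /residual /= value_cons => ->.
  by case=> v acc ->; exists v; rewrite //= value_cons !mulgA.
rewrite {1}/residual /= => ->; exists [::] => //.
by rewrite eta_nil value_nil !mul1g valueW.
Qed.

Lemma spelled_correct : rational_subset_membership s I <->
  labelled_path (edge T) ([::], (nfa_init I.1).+1) 1 ([::], 0).
Proof.
split=> [[v acc vE]|/spelled_residual]; last first.
  case=> v acc vE; exists v => //.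
  by apply/divg1_eq; rewrite vE /value big_nil mul1g.
have := spelled_complete acc; rewrite vE mulgV; exact.
Qed.

End Correct.

End Words.

(** * Deciding rational subset membership by saturation *)

Lemma computable_saturate X (S T : countType) (C : S -> seq T)
    (rule : S -> seq T -> T -> bool) :
  computable X C -> computable X (fun p => rule p.1 p.2.1 p.2.2) ->
  computable X (fun x => saturate (C x) (rule x)).
Proof.
move=> compC compr.
apply: (computable_iter (g := fun x => saturation_step (C x) (rule x))).
- exact: computable_size.
- rewrite /saturation_step.
  apply: (computable_filter (l := fun p : S * seq T => C p.1)
    (g := fun (p : S * seq T) e => (e \in p.2) || rule p.1 p.2 e)).
    by apply: (computable_comp compC); comp.
  comp; first by apply: computable_mem; comp.
  by apply: (computable_comp (f := fun q => (q.1.1, (q.1.2, q.2))) compr); comp.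
exact: computable_cst.
Qed.

Section Decision.
Variables (X : set nat) (K : groupType) (n : nat) (s : 'I_n -> K).
Local Notation ev := (Defs.eta s).
Variables (F : bool -> set K) (syllables : letter n -> seq (syllable n)).
Hypotheses (value_syllables : forall l, value s (syllables l) = ev [:: l])
  (syllables_factor : forall l, {in syllables l, forall y, F y.1 (ev y.2)})
  (F1 : forall b, F b 1).
Variables (L : finType) (val : L -> K).
Local Notation candidate := (state n * L * state n)%type.

(** Every edge really carries an element of the factor that it names. *)
Definition factored (T : seq (transition n)) : Prop :=
  {in T, forall t, F t.1.2.1 (ev t.1.2.2)}.

Definition true_for (T : seq (transition n)) (e : candidate) : Prop :=
  labelled_path (edge s T) e.1.1 (val e.1.2) e.2.

Definition endpoints (T : seq (transition n)) : seq (state n) :=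
  flatten [seq [:: t.1.1; t.2] | t <- T].

Definition candidates (Q : seq (state n)) : seq candidate :=
  flatten [seq flatten [seq [seq (p, b, q) | q <- Q] | b <- enum L] | p <- Q].

Lemma candidatesP Q p b q : ((p, b, q) \in candidates Q) = (p \in Q) && (q \in Q).
Proof.
apply/flatten_mapP/andP => [[p' pQ /flatten_mapP[b' _ /mapP[q' qQ]]] [-> _ ->] //|].
case=> pQ qQ; exists p => //; apply/flatten_mapP; exists b; rewrite ?mem_enum //.
by apply/mapP; exists q.
Qed.

Lemma computable_candidates : computable X candidates.
Proof.
apply: computable_flatten; apply: (computable_map (g := fun Q p =>
  flatten [seq [seq (p, b, q) | q <- Q] | b <- enum L])); comp.
apply: computable_flatten; apply: (computable_map (g := fun Qp b =>
  [seq (Qp.2, b, q) | q <- Qp.1])); comp.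
by apply: (computable_map (g := fun Qpb q => (Qpb.1.2, Qpb.2, q))); comp.
Qed.

Lemma mem_endpoints T t : t \in T -> (t.1.1 \in endpoints T) && (t.2 \in
  endpoints T).
Proof.
by move=> tT; apply/andP; split; apply/flatten_mapP; exists t => //;
  rewrite !inE eqxx ?orbT.
Qed.

Lemma computable_endpoints : computable X endpoints.
Proof.
by apply: computable_flatten; apply: (computable_map (g := fun _ t =>
  [:: t.1.1; t.2])); comp.
Qed.

Variable rule : seq (transition n) -> seq candidate -> candidate -> bool.
Hypothesis computable_rule : computable X (fun x => rule x.1 x.2.1 x.2.2).
Hypothesis rule_sound : forall T E e, factored T ->
  {in E, forall e', true_for T e'} -> rule T E e -> true_for T e.
Hypothesis rule_complete : forall T Q E p q, factored T ->
  {subset endpoints T <= Q} -> {subset E <= candidates Q} ->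
  {in candidates Q, forall e, rule T E e -> e \in E} ->
  p \in Q -> q \in Q -> labelled_path (edge s T) p 1 q ->
  exists2 b, (p, b, q) \in E & val b = 1.

Lemma chain_factored u r : {in u, forall y, F y.1 (ev y.2)} -> factored (chain u r).
Proof.
move=> uF _ /mapP[[x v] /suffixesP/suffixP[w uE] ->] /=; apply: uF.
by rewrite uE mem_cat mem_head orbT.
Qed.

Lemma spelled_factored I : factored (spelled syllables I).
Proof.
have F_nil : F true (ev [::]) by rewrite eta_nil; exact: F1.
move=> t; rewrite mem_cat => /orP[/flatten_mapP[e _]|].
  by rewrite inE => /predU1P[-> //|]; apply: chain_factored;
    exact: syllables_factor.
rewrite mem_cat => /orP[/mapP[f _ ->] //|]; apply: chain_factored => y.
by case/flatten_mapP=> l _; exact: syllables_factor.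
Qed.

(** An edge of the graph with its label in [val] is recorded by a candidate.  A
    rule that is sound, and complete for paths labelled 1 once it is saturated,
    decides rational subset membership. *)
Theorem computable_rational :
  computable X (fun I => `[< rational_subset_membership s I >]).
Proof.
pose start (I : nfa (letter n) * word n) : state n := ([::], (nfa_init I.1).+1).
pose stop : state n := ([::], 0).
pose T := spelled syllables.
pose Q (I : nfa (letter n) * word n) := [:: start I, stop & endpoints (T I)].
pose E (I : nfa (letter n) * word n) := saturate (candidates (Q I)) (rule (T I)).
have compT : computable X T by exact: computable_spelled.
have comp_start : computable X start.
  by rewrite /start; comp; apply: (computable_comp (computable_nfa_init _ _)); comp.
have compQ : computable X Q.
  rewrite /Q; comp; [exact: comp_start|].
  exact: (computable_comp computable_endpoints).
have compE : computable X E.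
  apply: (computable_saturate (rule := fun I => rule (T I))).
    exact: (computable_comp computable_candidates).
  apply: (computable_comp (f := fun p => (T p.1, p.2)) computable_rule).
  by comp; apply: (computable_comp compT); comp.
have /computable_ext : computable X (fun I =>
    has (fun e => [&& e.1.1 == start I, val e.1.2 == 1 & e.2 == stop]) (E I)).
  apply: (computable_has (g := fun I e =>
    [&& e.1.1 == start I, val e.1.2 == 1 & e.2 == stop])) => //.
  comp; first by apply: (computable_comp comp_start); comp.
  by apply: (computable_comp (computable_fin _ (fun b => val b == 1))); comp.
apply=> I; have TF := @spelled_factored I.
apply/idP/asboolP; rewrite (spelled_correct value_syllables).
  case/hasP=> -[[p b] q] bE /= /and3P[/eqP eq_p /eqP vb /eqP eq_q].
  have := saturate_sound (P := true_for (T I)) _ bE; rewrite /true_for /=.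
  by rewrite eq_p vb eq_q; apply=> E' e; exact: rule_sound.
move=> pathI;
  have [|||||b bE vb] := rule_complete (Q := Q I) (E := E I) TF _ _ _ _ _ pathI.
- by move=> p pT; rewrite !inE pT !orbT.
- exact: saturate_sub.
- by move=> e; exact: saturate_closed.
- by rewrite inE eqxx.
- by rewrite !inE eqxx orbT.
by apply/hasP; exists (start I, b, stop); rewrite //= !eqxx vb eqxx.
Qed.

End Decision.

Section WordProblem.
Variables (K : groupType) (n : nat) (s : 'I_n -> K).
Local Notation ev := (Defs.eta s).
Local Notation membership := (submonoid_membership s).

Lemma membershipP (D : seq (word n)) w : membership (D, w) <->
  exists2 ws, {subset ws <= D} & \prod_(d <- ws) ev d = ev w.
Proof.
split=> [[v [ws /= wsD <-]]|[ws wsD wsE]].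
  by rewrite eta_flatten => wsE; exists ws.
by exists (flatten ws); [exists ws | rewrite eta_flatten].
Qed.

Lemma membership_nil w : membership ([::], w) <-> ev w = 1.
Proof.
rewrite membershipP; split=> [[ws wsD <-]|w1]; last by exists [::];
  rewrite ?big_nil.
case: ws wsD => [|d ws] wsD; first by rewrite big_nil.
by have := wsD d (mem_head _ _).
Qed.

End WordProblem.

Section FiniteFactors.
Variables (K : groupType) (n : nat) (s : 'I_n -> K).
Local Notation ev := (Defs.eta s).
Local Notation membership := (submonoid_membership s).
Variables (F : bool -> set K) (A : set K) (P : ping_pong F A).
Hypotheses (A1 : A 1) (AV : forall x, A x -> A x^-1)
  (AM : forall x y, A x -> A y -> A (x * y))
  (AF : forall b, A `<=` F b)
  (FM : forall b x y, F b x -> F b y -> F b (x * y)).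
Variables (L : finType) (val : L -> K) (L_word : L -> word n).
Hypotheses (L_wordE : forall a, ev (L_word a) = val a)
  (F_val : forall b x, F b x -> exists a, val a = x).
Local Notation candidate := (state n * L * state n)%type.

(** If [val] exhausts both factors, paths inside a factor can be recorded one
    multiplication at a time; the oracle serves only to evaluate the labels of
    edges, a word being trivial if it is in the trivial submonoid. *)
Definition finite_rule (T : seq (transition n)) (E : seq candidate)
    (e : candidate) : bool :=
  [|| (e.1.1 == e.2) && (val e.1.2 == 1),
      has (fun t => [&& t.1.1 == e.1.1, t.2 == e.2 &
             `[< membership ([::], t.1.2.2 ++ word_inv (L_word e.1.2)) >]]) T |
      has (fun e1 => has (fun e2 => [&& e1.1.1 == e.1.1, e1.2 == e2.1.1,
             e2.2 == e.2 & val e1.1.2 * val e2.1.2 == val e.1.2]) E) E].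

Lemma computable_finite_rule :
  computable (codes membership) (fun x => finite_rule x.1 x.2.1 x.2.2).
Proof.
rewrite /finite_rule; comp.
- by apply: (computable_comp (computable_fin _ (fun b => val b == 1))); comp.
- apply: (computable_has (g := fun x t => [&& t.1.1 == x.2.2.1.1, t.2 == x.2.2.2 &
    `[< membership ([::], t.1.2.2 ++ word_inv (L_word x.2.2.1.2)) >]])); comp.
  apply: (computable_comp (computable_oracle membership)); comp.
  apply: computable_cat; comp.
  apply: (computable_comp (computable_fin _ (fun a => word_inv (L_word a)))); comp.
apply: (computable_has (g := fun x e1 => has (fun e2 =>
  [&& e1.1.1 == x.2.2.1.1, e1.2 == e2.1.1,
   e2.2 == x.2.2.2 & val e1.1.2 * val e2.1.2 == val x.2.2.1.2]) x.2.1)); comp.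
apply: (computable_has (g := fun x e2 =>
  [&& x.2.1.1 == x.1.2.2.1.1, x.2.2 == e2.1.1,
   e2.2 == x.1.2.2.2 & val x.2.1.2 * val e2.1.2 == val x.1.2.2.1.2])); comp.
by apply: (computable_comp (computable_fin _
  (fun c : L * L * L => val c.1.1 * val c.1.2 == val c.2))
  (f := fun x => (x.1.2.1.2, x.2.1.2, x.1.1.2.2.1.2))); comp.
Qed.

Lemma finite_rule_sound T E e : {in E, forall e', true_for s val T e'} ->
  finite_rule T E e -> true_for s val T e.
Proof.
case: e => [[p b] q] soundE; rewrite /finite_rule /true_for /= => /or3P[].
- by move=> /andP[/eqP -> /eqP ->]; exact: path_nil.
- case/hasP=> -[[p' y] q'] tT /and3P[/eqP /= <- /eqP <- /asboolP/membership_nil].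
  rewrite eta_cat eta_inv L_wordE => /divg1_eq <-; apply: path1.
  by exists y.
case/hasP=> -[[p1 b1] q1] e1E /hasP[[[p2 b2] q2] e2E] /=.
move=> /and4P[/eqP <- /eqP q1E /eqP <- /eqP <-].
by apply: path_cat (soundE _ e1E) _; rewrite /= q1E; exact: (soundE _ e2E).
Qed.

Lemma finite_rule_complete T Q E p q : factored s F T ->
  {subset endpoints T <= Q} -> {subset E <= candidates L Q} ->
  {in candidates L Q, forall e, finite_rule T E e -> e \in E} ->
  p \in Q -> q \in Q -> labelled_path (edge s T) p 1 q ->
  exists2 b, (p, b, q) \in E & val b = 1.
Proof.
move=> TF TQ EQ closedE pQ qQ path_pq.
pose C b p x q := F b x /\ exists2 a, (p, a, q) \in E & val a = x.
suff [_ //] : C true p 1 q.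
apply: (amalgamated_path_closed P A1 AV AM (R := edge s T) (C := C)) => //.
- by move=> b p' x q' [].
- move=> b p1 x p2 y p3 [Fx [a aE ax]] [Fy [a' aE' ay]].
  have Fxy := FM Fx Fy; split=> //; have [c cxy] := F_val Fxy; exists c => //.
  have := EQ _ aE; have := EQ _ aE';
    rewrite !candidatesP => /andP[_ p3Q] /andP[p1Q _].
  apply: closedE; first by rewrite candidatesP p1Q.
  apply/or3P/Or33/hasP; exists (p1, a, p2) => //; apply/hasP;
    exists (p2, a', p3) => //=.
  by rewrite !eqxx ax ay cxy eqxx.
- by move=> b p' x q' [_ ?] Ax; split=> //; exact: AF.
- move=> p' x q' [y tT ->]; exists y.1; have Fy := TF _ tT; split=> //=.
  have [a ay] := F_val Fy; exists a => //.
  have /andP[/TQ p'Q /TQ q'Q] := mem_endpoints tT.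
  apply: closedE; first by rewrite candidatesP p'Q.
  apply/or3P/Or32/hasP; exists (p', y, q') => //=; rewrite !eqxx /=.
  by apply/asboolP/membership_nil; rewrite eta_cat eta_inv L_wordE ay mulgV.
move=> b; have Fb1 : F b 1 by exact: AF.
split=> //; have [a a1] := F_val Fb1; exists a => //.
apply: closedE; first by rewrite candidatesP qQ.
by apply/or3P/Or31; rewrite /= a1 !eqxx.
Qed.

End FiniteFactors.

(** * Asking for paths inside a factor through submonoid membership *)

Section EncodedRule.
Variables (K : groupType) (n : nat) (s : 'I_n -> K).
Local Notation ev := (Defs.eta s).
Local Notation membership := (submonoid_membership s).
Variables (F : bool -> set K) (A : set K) (P : ping_pong F A).
Hypotheses (A1 : A 1) (AV : forall x, A x -> A x^-1)
  (AM : forall x y, A x -> A y -> A (x * y))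
  (AF : forall b, A `<=` F b) (FV : forall b x, F b x -> F b x^-1)
  (FM : forall b x y, F b x -> F b y -> F b (x * y)).
Variables (L : finType) (val : L -> K) (L_word : L -> word n).
Hypotheses (L_wordE : forall a, ev (L_word a) = val a)
  (A_val : forall x, A x <-> exists a, val a = x).
Variables (d : bool) (u v : word n) (star : bool -> word n).
Hypotheses (Fu : F d (ev u)) (nAu : ~ A (ev u)) (Fv : F d (ev v)) (nAv : ~ A (ev v))
  (nAuv : ~ A (ev u * (ev v)^-1)).
Hypotheses (F_star : forall b, F b (ev (star b)))
  (nA_star : forall b, ~ A (ev (star b)))
  (star_conj : forall b a, A a -> a <> 1 -> ~ A (a ^ ev (star b))).
Local Notation candidate := (state n * L * state n)%type.

Definition left_word (q : nat) : word n :=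
  iter q (cat (word_inv v ++ star (~~ d))) (word_inv u).

Definition right_word (q : nat) : word n :=
  iter q (fun w => w ++ (star (~~ d) ++ u)) v.

Definition prefix_word (b : bool) : word n :=
  if b == d then star (~~ d) ++ star d else star d.

Definition code_word (b : bool) (q : nat) : word n :=
  (prefix_word b ++ (star (~~ d) ++ left_word q)) ++ (star (~~ d) ++ right_word q).

Lemma code_wordE b q :
  ev (code_word b q) = code d (ev u) (ev v) (fun b => ev (star b)) b q.
Proof.
rewrite /code_word /code /code_head !eta_cat; congr (_ * (_ * _) * (_ * _)).
- by rewrite /prefix_word /prefix_code; case: eqP; rewrite ?eta_cat.
- rewrite /left_word; elim: q => [|q IHq] /=; first by rewrite eta_inv.
  by rewrite !eta_cat eta_inv IHq.
rewrite /right_word; elim: q => [|q IHq] //=.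
by rewrite !eta_cat IHq mulgA.
Qed.

Lemma computable_code_word X b : computable X (code_word b).
Proof.
apply: computable_cat; apply: computable_cat; comp.
  apply: computable_cat; comp.
  apply: (computable_iter (g := fun _ : nat => cat (word_inv v ++ star (~~
    d)))); comp.
  by apply: computable_cat; comp.
apply: (computable_iter (g := fun (_ : nat) w => w ++ (star (~~ d) ++ u))); comp.
by apply: computable_cat; comp.
Qed.

Definition encoded b (p : state n) (w : word n) (q : state n) : word n :=
  word_inv (code_word b (pickle p)) ++ (w ++ code_word b (pickle q)).

Local Notation c b q :=
  (code d (ev u) (ev v) (fun b => ev (star b)) b (pickle q)).

Lemma encodedE b p w q : ev (encoded b p w q) = (c b p)^-1 * ev w * c b q.
Proof. by rewrite /encoded eta_cat eta_inv (eta_cat s w) !code_wordE mulgA. Qed.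

Lemma computable_encoded X b (S : countType) (p q : S -> state n) (w : S ->
  word n) :
  computable X p -> computable X w -> computable X q ->
  computable X (fun x => encoded b (p x) (w x) (q x)).
Proof.
have compc (r : S -> state n) : computable X r ->
    computable X (fun x => code_word b (pickle (r x))).
  move=> compr; apply: (computable_comp (computable_code_word _ b)).
  exact: computable_pickle.
move=> compp compw compq; rewrite /encoded; apply: computable_cat.
  by apply: (computable_comp (computable_word_inv _ _)); exact: compc.
by apply: computable_cat => //; exact: compc.
Qed.

(** The edges inside the factor [b] and the recorded edges, as generators of a
    submonoid. *)
Definition generators b (T : seq (transition n)) (E : seq candidate) : seq
  (word n) :=
  [seq encoded b t.1.1 t.1.2.2 t.2 | t <- T & t.1.2.1 == b] ++
  [seq encoded b e.1.1 (L_word e.1.2) e.2 | e <- E].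

(** The edge [e] is recorded if a path inside one of the factors has its label. *)
Definition encoded_rule T E (e : candidate) : bool :=
  let ask b := `[< membership (generators b T E,
                               encoded b e.1.1 (L_word e.1.2) e.2) >] in
  ask true || ask false.

Lemma computable_encoded_rule :
  computable (codes membership) (fun x => encoded_rule x.1 x.2.1 x.2.2).
Proof.
have compL (S : countType) (a : S -> L) : computable (codes membership) a ->
    computable (codes membership) (fun x => L_word (a x)).
  exact: (computable_comp (computable_fin _ L_word)).
have ask b : computable (codes membership) (fun x => `[< membership
    (generators b x.1 x.2.1, encoded b x.2.2.1.1 (L_word x.2.2.1.2) x.2.2.2) >]).
  apply: (computable_comp (computable_oracle membership)); comp; last first.
    by apply: computable_encoded; [comp| apply: compL; comp|comp].
  apply: computable_cat.
    apply: (computable_map (g := fun _ t => encoded b t.1.1 t.1.2.2 t.2)).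
      by apply: (computable_filter (g := fun _ t => t.1.2.1 == b)); comp.
    by apply: computable_encoded; comp.
  apply: (computable_map (g := fun _ e => encoded b e.1.1 (L_word e.1.2) e.2));
    comp.
  by apply: computable_encoded; [comp| apply: compL; comp|comp].
by rewrite /encoded_rule; comp; exact: ask.
Qed.

Definition factor_edge b (T : seq (transition n)) (E : seq candidate)
    (p : state n) (x : K) (q : state n) : Prop :=
  (exists2 w, (p, (b, w), q) \in T & x = ev w) \/
  (exists2 a, (p, a, q) \in E & x = val a).

Lemma factor_edge_factor b T E p x q : factored s F T ->
  factor_edge b T E p x q -> F b x.
Proof.
move=> TF [[w tT ->]|[a _ ->]]; first exact: (TF _ tT).
by apply: AF; apply/A_val; exists a.
Qed.

Lemma generators_edge b T E : {in generators b T E, forall g,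
  exists t : state n * K * state n, factor_edge b T E t.1.1 t.1.2 t.2 /\
    ev g = (c b t.1.1)^-1 * t.1.2 * c b t.2}.
Proof.
move=> g; rewrite mem_cat => /orP[/mapP[[[p [b' w]] q]]|/mapP[[[p a] q] aE ->]].
  rewrite mem_filter /= => /andP[/eqP -> tT] ->; exists (p, ev w, q).
  by rewrite encodedE; split=> //; left; exists w.
exists (p, val a, q); rewrite encodedE L_wordE; split=> //.
by right; exists a.
Qed.

Lemma edge_generators b T E p x q : factor_edge b T E p x q ->
  exists2 g, g \in generators b T E & ev g = (c b p)^-1 * x * c b q.
Proof.
case=> [[w tT ->]|[a aE ->]].
  exists (encoded b p w q); last exact: encodedE.
  rewrite mem_cat; apply/orP; left; apply/mapP; exists (p, (b, w), q) => //.
  by rewrite mem_filter /= eqxx.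
exists (encoded b p (L_word a) q); last by rewrite encodedE L_wordE.
by rewrite mem_cat; apply/orP; right; apply/mapP; exists (p, a, q).
Qed.

(** Inner codes cancel along a path; the converse is [encoding_faithful]. *)
Lemma membership_path b T E p w q : factored s F T -> F b (ev w) ->
  membership (generators b T E, encoded b p w q) <->
  labelled_path (factor_edge b T E) p (ev w) q.
Proof.
move=> TF Fw; rewrite membershipP encodedE; split=> [[ws wsG prodE]|].
  have [ts tsE prod_ts] : exists2 ts : seq (state n * K * state n),
      {in ts, forall t, factor_edge b T E t.1.1 t.1.2 t.2} &
      \prod_(g <- ws) ev g = \prod_(t <- ts) ((c b t.1.1)^-1 * t.1.2 * c b t.2).
    elim: ws wsG {prodE} => [|g ws IHws] wsG; first by exists [::];
      rewrite ?big_nil.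
    have [|ts tsE prod_ts] := IHws.
      by move=> g' g'ws; apply: wsG; rewrite inE g'ws orbT.
    have [t [tE gE]] := generators_edge (wsG g (mem_head _ _)).
    exists (t :: ts); last by rewrite !big_cons gE prod_ts.
    by move=> t'; rewrite inE => /predU1P[->|/tsE].
  rewrite prod_ts in prodE.
  have F1 b' : F b' 1 by exact: AF.
  apply: (encoding_faithful P A1 AV AF F1 FV FM Fu nAu Fv nAv nAuv
    (star := fun b' => ev (star b')) F_star nA_star star_conj
    (num := pickle) (pcan_inj pickleK) _ Fw tsE prodE).
  by move=> p' x q'; exact: factor_edge_factor.
elim=> {p q} [p|p x q z r /edge_generators[g gG gE] _ [ws wsG wsE]].
  by exists [::]; rewrite ?big_nil ?mulg1 ?mulVg.
have assoc (a x1 e x2 a' : K) : a * x1 * e * (e^-1 * x2 * a') = a * (x1 * x2) * a'.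
  by rewrite !mulgA mulgK.
exists (g :: ws); last by rewrite big_cons gE wsE assoc.
by move=> g'; rewrite inE => /predU1P[->|/wsG].
Qed.

Lemma encoded_rule_sound T E e : factored s F T ->
  {in E, forall e', true_for s val T e'} -> encoded_rule T E e ->
  true_for s val T e.
Proof.
move=> TF soundE ask_e; have [b] : exists b, membership
    (generators b T E, encoded b e.1.1 (L_word e.1.2) e.2).
  by case/orP: ask_e => /asboolP; [exists true | exists false].
have Fe : F b (ev (L_word e.1.2)).
  by apply: AF; rewrite L_wordE; apply/A_val; exists e.1.2.
move/(membership_path _ _ _ TF Fe); rewrite L_wordE; apply: path_sub => p x q.
case=> [[w tT ->]|[a aE ->]]; last exact: (soundE _ aE).
by apply: path1; exists (b, w).
Qed.

Lemma encoded_rule_complete T Q E p q : factored s F T ->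
  {subset endpoints T <= Q} -> {subset E <= candidates L Q} ->
  {in candidates L Q, forall e, encoded_rule T E e -> e \in E} ->
  p \in Q -> q \in Q -> labelled_path (edge s T) p 1 q ->
  exists2 b, (p, b, q) \in E & val b = 1.
Proof.
move=> TF TQ EQ closedE pQ qQ path_pq.
pose C b p x q := [/\ p \in Q, q \in Q & labelled_path (factor_edge b T E) p x q].
have C_E b p' x q' : C b p' x q' -> A x -> exists2 a, (p', a, q') \in E & val a = x.
  move=> [p'Q q'Q path_x] /A_val[a ax]; exists a => //.
  apply: closedE; first by rewrite candidatesP p'Q.
  have Fa : F b (ev (L_word a)) by apply: AF; rewrite L_wordE; apply/A_val;
    exists a.
  have ask : `[< membership (generators b T E, encoded b p' (L_word a) q') >].
    by apply/asboolP/(membership_path _ _ _ TF Fa); rewrite L_wordE ax.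
  by rewrite /encoded_rule /=; case: b {path_x Fa} ask => ->; rewrite ?orbT.
apply: (C_E true) => //;
  apply: (amalgamated_path_closed P A1 AV AM (R := edge s T) (C := C)) => //.
- move=> b p' x q' [_ _]; apply: path_closed => [|x1 x2|p1 x1 p2].
  + exact: AF.
  + exact: FM.
  exact: factor_edge_factor.
- move=> b p1 x p2 y p3 [p1Q _ path_x] [_ p3Q path_y]; split=> //.
  exact: path_cat path_y.
- move=> b p' x q' Cx Ax; have [p'Q q'Q _] := Cx; split=> //.
  by have [a aE ax] := C_E _ _ _ _ Cx Ax; apply: path1; right; exists a.
- move=> p' x q' [[b w] tT ->]; exists b.
  have /andP[/TQ p'Q /TQ q'Q] := mem_endpoints tT; split=> //.
  by apply: path1; left; exists w.
by move=> b; split=> //; exact: path_nil.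
Qed.

End EncodedRule.

(** * The reduction for amalgamated free products *)

Section Reduction.
Variables (K : groupType) (n : nat) (s : 'I_n -> K) (s_gen : generates s).
Local Notation ev := (Defs.eta s).
Variables (F : bool -> set K) (A : set K) (P : ping_pong F A).
Hypotheses (A1 : A 1) (AV : forall x, A x -> A x^-1)
  (AM : forall x y, A x -> A y -> A (x * y))
  (AF : forall b, A `<=` F b) (FV : forall b x, F b x -> F b x^-1)
  (FM : forall b x y, F b x -> F b y -> F b (x * y)).
Variables (L : finType) (val : L -> K).
Hypothesis A_val : forall x, A x <-> exists a, val a = x.
Hypothesis F_gen : forall z, exists2 l : seq K,
  (forall x, x \in l -> exists b, F b x) & z = \prod_(x <- l) x.
Variable star : bool -> K.
Hypotheses (F_star : forall b, F b (star b)) (nA_star : forall b, ~ A (star b))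
  (star_conj : forall b a, A a -> a <> 1 -> ~ A (a ^ star b)).

Lemma word_of z : exists w, ev w = z.
Proof. by have [w _ wz] : range ev z; [rewrite s_gen | exists w]. Qed.

Lemma syllables_exist : exists syl : letter n -> seq (syllable n), forall l,
  value s (syl l) = ev [:: l] /\ {in syl l, forall y, F y.1 (ev y.2)}.
Proof.
suff spell l : exists u : seq (syllable n),
    value s u = ev [:: l] /\ {in u, forall y, F y.1 (ev y.2)}.
  by have [syl sylP] := choice spell; exists syl.
have [xs + ->] := F_gen (ev [:: l]); elim: xs => [|x xs IHxs] xsF.
  by exists [::]; rewrite /value !big_nil.
have [|u [uE uF]] := IHxs; first by move=> y yxs; apply: xsF; rewrite inE yxs orbT.
have [b Fx] := xsF x (mem_head _ _); have [w wx] := word_of x.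
exists ((b, w) :: u); split; first by rewrite value_cons big_cons uE wx.
by move=> y; rewrite inE => /predU1P[->|/uF //] /=; rewrite wx.
Qed.

(** If no factor contains suitable elements [u] and [v], then [A] is trivial: for
    [a <> 1] in [A] and [z := star true], the elements [z^-1] and [z^-1 * a] are
    outside [A], so their quotient is in [A]; but it is the conjugate of [a^-1]
    by [z].  Then the only elements of the factor [b] are 1 and [star b]. *)
Lemma rational_reducible_submonoid :
  turing_reducible (rational_subset_membership s) (submonoid_membership s).
Proof.
apply: turing_reducible_computable.
  have decw := decidable_codes_seq (decidable_codes_pair
    (decidable_codes_fin (codes (submonoid_membership s)) 'I_n)
    (decidable_codes_fin (codes (submonoid_membership s)) bool)).
  apply: decidable_codes_pair => //; apply: decidable_codes_nfa.
  by apply: decidable_codes_pair; exact: decidable_codes_fin.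
have F1 b : F b 1 by exact: AF.
have [syl sylP] := syllables_exist.
have syl_value l := (sylP l).1; have syl_factor l := (sylP l).2.
have words (T : Type) (f : T -> K) : exists g : T -> word n, forall x, ev (g x)
  = f x.
  by have [g gE] := choice (fun x => word_of (f x)); exists g.
have [starw starE] := words _ star.
have [[d [u [v [Fu nAu Fv nAv nAuv]]]]|small] := pselect (exists d u v,
    [/\ F d u, ~ A u, F d v, ~ A v & ~ A (u * v^-1)]).
  have [uw uE] := word_of u; have [vw vE] := word_of v.
  have [valw valE] := words _ val.
  rewrite -{}uE -?{}vE in Fu nAu Fv nAv nAuv *.
  have F_starw b : F b (ev (starw b)) by rewrite starE.
  have nA_starw b : ~ A (ev (starw b)) by rewrite starE.
  have starw_conj b a : A a -> a <> 1 -> ~ A (a ^ ev (starw b)).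
    by rewrite starE; exact: star_conj.
  apply: (computable_rational syl_value syl_factor F1).
  - exact: (computable_encoded_rule s valw d uw vw starw).
  - move=> T E e; exact: (encoded_rule_sound P A1 AV AF FV FM valE A_val Fu nAu
      Fv nAv nAuv F_starw nA_starw starw_conj).
  move=> T Q E p q; exact: (encoded_rule_complete P A1 AV AM AF FV FM valE A_val
    Fu nAu Fv nAv nAuv F_starw nA_starw starw_conj).
have index2 d u v : F d u -> ~ A u -> F d v -> ~ A v -> A (u * v^-1).
  by move=> *; apply: contrapT => nAuv; apply: small; exists d, u, v.
have A_trivial a : A a -> a = 1.
  move=> Aa; apply: contrapT => a1; have nAz := nA_star (b := true).
  have Fz := FV (F_star true).
  have nAzV : ~ A (star true)^-1 by move=> /AV; rewrite invgK; exact: nA_star.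
  have AVa := AV Aa; have aV1 : a^-1 <> 1 by move=> /(congr1 inv);
    rewrite invgK invg1.
  apply: (star_conj (b := true) AVa aV1).
  have -> : a^-1 ^ star true = (star true)^-1 * ((star true)^-1 * a)^-1.
    by rewrite conjgE invMg invgK.
  apply: (index2 true) => //; first by apply: FM => //; exact: AF.
  by move=> /AM/(_ AVa); rewrite mulgK.
pose val2 (o : option bool) := if o is Some b then star b else 1.
have F_val2 b x : F b x -> exists o, val2 o = x.
  move=> Fx; have [->|x1] := pselect (x = 1); first by exists None.
  exists (Some b); apply/esym/divg1_eq/A_trivial/(index2 b) => //.
    by move/A_trivial.
  exact: nA_star.
have [val2w val2E] := words _ val2.
apply: (computable_rational syl_value syl_factor F1 (val := val2)
  (rule := finite_rule s val2 val2w)).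
- exact: (computable_finite_rule s val2 val2w).
- move=> T E e _; exact: finite_rule_sound.
move=> T Q E p q; exact: (finite_rule_complete P A1 AV AM AF FM val2E F_val2).
Qed.

End Reduction.

(** If the given element [g] is in [A], then [A] is its own conjugate and hence
    trivial, and any element outside [A] will do. *)
Lemma disjoint_conjugator (A G : groupType) (j : {multiplicative A -> G}) :
  range j `<` [set: G] ->
  (exists g : G, [set x ^ g | x in range j] `&` range j = [set 1]) ->
  exists z, ~ range j z /\ forall a, range j a -> a <> 1 -> ~ range j (a ^ z).
Proof.
move=> properj [g gP]; have meet1 a : range j a -> range j (a ^ g) -> a = 1.
  move=> ja jag; have : [set 1] (a ^ g) by rewrite -gP; split=> //; exists a.
  by move=> /= /(congr1 (conjg^~ g^-1)); rewrite conjgK conj1g.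
have [[b _ bg]|ng] := pselect (range j g); last first.
  by exists g; split=> // a ja a1 /(meet1 _ ja).
have [z nz] : exists z, ~ range j z.
  case: properj => _ notsub; apply: contrapT => noz; apply: notsub => x _.
  by apply: contrapT => nx; apply: noz; exists x.
exists z; split=> // a ja a1 _; apply/a1/meet1 => //.
by case: ja => c _ <-; exists (c ^ b);
  rewrite // -bg conjgE !gmulfM multiplicativeV.
Qed.

Theorem theorem4 (A : finGroupType) (G H K : groupType)
    (jG : {multiplicative A -> G}) (jH : {multiplicative A -> H})
    (iG : {multiplicative G -> K}) (iH : {multiplicative H -> K})
    (jG_inj : injective jG) (jH_inj : injective jH)
    (G_fg : finitely_generated G) (H_fg : finitely_generated H)
    (A_properG : range jG `<` [set: G]) (A_properH : range jH `<` [set: H])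
    (A_conjG : exists g : G,
      [set x ^ g | x in range jG] `&` range jG = [set 1])
    (A_conjH : exists h : H,
      [set y ^ h | y in range jH] `&` range jH = [set 1])
    (K_amalgam : is_amalgam jG jH iG iH)
    (n : nat) (s : 'I_n -> K) (s_gen : generates s) :
  recursively_equivalent (rational_subset_membership s)
    (submonoid_membership s).
Proof.
split; last exact: submonoid_reducible_rational.
have [z [nz zP]] := disjoint_conjugator A_properG A_conjG.
have [y [ny yP]] := disjoint_conjugator A_properH A_conjH.
pose F := factor iG iH; pose AA := amalgamated jG iG.
have AA_E x : AA x <-> exists a, iG (jG a) = x.
  by split=> [[a _ <-]|[a <-]]; exists a.
have AA1 : AA 1 by apply/AA_E; exists 1; rewrite !multiplicative1.
have AAV x : AA x -> AA x^-1.
  by move=> [a _ <-]; apply/AA_E; exists a^-1; rewrite !multiplicativeV.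
have AAM x x' : AA x -> AA x' -> AA (x * x').
  by move=> [a _ <-] [a' _ <-]; apply/AA_E; exists (a * a'); rewrite !gmulfM.
have FM b x x' : F b x -> F b x' -> F b (x * x').
  by case: b => -[a _ <-] [a' _ <-]; exists (a * a'); rewrite ?gmulfM.
pose star (b : bool) := if b then iG z else iH y.
have P := amalgam_ping_pong jG_inj jH_inj K_amalgam.
apply: (rational_reducible_submonoid s_gen P AA1 AAV AAM _ _ FM AA_E _ (star :=
  star)).
- by move=> b x; exact: (amalgamated_factor K_amalgam).
- by move=> b x; exact: factorV.
- move=> x; have /asboolP := amalgam_generated K_amalgam x; exact.
- by case; [exists z | exists y].
- case=> [/(amalgamatedG jG_inj jH_inj K_amalgam)|/(amalgamatedH jG_inj jH_inj
  K_amalgam)];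
    [exact: nz | exact: ny].
case=> a [c _ <-] c1; rewrite /star.
  have -> : iG (jG c) ^ iG z = iG (jG c ^ z) by rewrite !conjgE !gmulfM
    multiplicativeV.
  move/(amalgamatedG jG_inj jH_inj K_amalgam); apply: zP; first by exists c.
  by move=> jc1; apply: c1; rewrite jc1 multiplicative1.
rewrite (amalgam_jE K_amalgam).
have -> : iH (jH c) ^ iH y = iH (jH c ^ y) by rewrite !conjgE !gmulfM
  multiplicativeV.
move/(amalgamatedH jG_inj jH_inj K_amalgam); apply: yP; first by exists c.
by move=> jc1; apply: c1; rewrite (amalgam_jE K_amalgam) jc1 multiplicative1.
Qed.
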